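(* Let $f:A\rightarrow B$ be a ring homomorphism and $J$ an ideal of $B$. Then $A\bowtie^f J$ is a $\tau_q$-semisimple ring if and only if $A$ is reduced, $\mathrm{Nil}(B)\cap J=0$, and $\{\mathfrak p'^f\mid \mathfrak p\in \mathrm{Min}(A)-\mathcal{X}\}$ and $\{\overline{\mathfrak q}^f\mid \mathfrak q\in \mathrm{Min}(B)-V(J)\}$ are finite sets.
   Context: All rings are commutative with identity. The amalgamation of $A$ with $B$ along $J$ with respect to $f$ is the subring $A\bowtie^fJ=\{(a,f(a)+j): a\in A, j\in J\}$ of $A\times B$. $\mathrm{Nil}$ denotes the nilradical, $\mathrm{Min}$ the set of minimal primes, and $V(I)$ the set of primes containing the ideal $I$. For $\mathfrak p\in\mathrm{Spec}(A)$ and $\mathfrak q\in\mathrm{Spec}(B)$ set $\mathfrak p'^f=\{(p,f(p)+j): p\in\mathfrak p, j\in J\}$ and $\overline{\mathfrak q}^f=\{(a,f(a)+j)\in A\bowtie^f J: f(a)+j\in\mathfrak q\}$. Set $\mathcal{X}=\bigcup_{\mathfrak q\in\mathrm{Spec}(B)-V(J)}V(f^{-1}(\mathfrak q+J))$. For a ring $R$: an ideal $I$ is dense if $(0:_R I)=\{r\in R: Ir=0\}=0$, and semi-regular if it contains a finitely generated dense ideal. $\mathcal{Q}$ denotes the set of finitely generated semi-regular ideals of $R$. An $R$-module $N$ is $\mathcal Q$-torsion-free if $Iy=0$ with $I\in\mathcal Q$, $y\in N$ implies $y=0$. A $\mathcal Q$-torsion-free module $N$ is strongly Lucas if $\mathrm{Ext}^n_R(R/I,N)=0$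 for every $I\in\mathcal Q$ and every $n\ge1$. An $R$-module $P$ is $\tau_q$-projective if $\mathrm{Ext}^1_R(P,N)=0$ for every strongly Lucas $R$-module $N$. The $\tau_q$-projective dimension $\tau_q\text{-pd}_R(M)$ is the least $n\ge 0$ such that there is an exact sequence $0\to P_n\to\cdots\to P_0\to M\to 0$ with all $P_i$ $\tau_q$-projective ($\infty$ if none exists), and $\tau_q\text{-gl.dim}(R)=\sup\{\tau_q\text{-pd}_R(M): M\text{ an }R\text{-module}\}$. $R$ is $\tau_q$-semisimple if $\tau_q\text{-gl.dim}(R)=0$, i.e. every $R$-module is $\tau_q$-projective. *)

(* Defs.v *)
From HB Require Import structures.
From mathcomp Require Import all_boot all_order all_algebra.
From mathcomp Require Import generic_quotient ring_quotient.
From mathcomp Require Import boolp classical_sets cardinality constructive_ereal.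

Set Implicit Arguments.
Unset Strict Implicit.
Unset Printing Implicit Defensive.

Import Order.TTheory GRing.Theory Num.Theory.
Local Open Scope classical_set_scope.
Local Open Scope ring_scope.

(* Commutative rings with identity are comPzRingType (the zero ring is        *)
(* allowed), R-modules are lmodType R.                                        *)

Section Ideals.
Variable R : comPzRingType.
Implicit Types I P : set R.

Definition is_ideal I :=
  [/\ I 0, forall x y, I x -> I y -> I (x + y) & forall a x, I x -> I (a * x)].

Definition is_prime_ideal P :=
  [/\ is_ideal P, ~ P 1 & forall x y, P (x * y) -> P x \/ P y].

Definition Spec : set (set R) := [set P | is_prime_ideal P].

Definition V I : set (set R) := [set P | Spec P /\ I `<=` P].

Definition Min : set (set R) :=
  [set P | Spec P /\ forall P', Spec P' -> P' `<=` P -> P' = P].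

Definition nilradical : set R := [set x | exists n, x ^+ n = 0].

Definition reduced := nilradical = [set 0].

Definition dense I := forall r, (forall x, I x -> x * r = 0) -> r = 0.

Definition fin_generated I := exists (n : nat) (g : 'I_n -> R),
  I = [set x | exists c : 'I_n -> R, x = \sum_i c i * g i].

Definition semiregular I := exists I0,
  [/\ is_ideal I0, fin_generated I0, dense I0 & I0 `<=` I].

Record ideal := Ideal { ideal_set :> set R; idealP : is_ideal ideal_set }.

Definition fg_semiregular (I : ideal) := fin_generated I /\ semiregular I.

Definition ideal_pred (I : ideal) : {pred R} := fun x => `[< ideal_set I x >].

Fact ideal_pred_zmod_closed (I : ideal) : zmod_closed (ideal_pred I).
Proof.
case: I => I [I0 ID IM]; split; first exact/asboolP.
move=> x y /asboolP Ix /asboolP Iy; apply/asboolP => /=.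
by apply: (ID _ _ Ix); rewrite -mulN1r; apply: (IM _ _ Iy).
Qed.

HB.instance Definition _ (I : ideal) :=
  GRing.isZmodClosed.Build R (ideal_pred I) (ideal_pred_zmod_closed I).

End Ideals.
Arguments Spec R : clear implicits.
Arguments Min R : clear implicits.
Arguments nilradical R : clear implicits.

(* The R-module R/I; the additive quotient comes from ring_quotient.          *)
Section QuotientModule.
Variables (R : comPzRingType) (I : ideal R).
Local Open Scope quotient_scope.

Definition quotmod : Type := {ideal_quot ideal_pred I}.
HB.instance Definition _ := GRing.Zmodule.on quotmod.
HB.instance Definition _ := EqQuotient.on quotmod.

Definition quotmod_pi : R -> quotmod := \pi_quotmod.
Definition quotmod_scale (a : R) (u : quotmod) : quotmod :=
  quotmod_pi (a * repr u).

Fact quotmod_pi_eq (x y : R) :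
  (quotmod_pi x == quotmod_pi y) = (x - y \in ideal_pred I).
Proof. by rewrite Quotient.idealrBE. Qed.

Fact quotmod_piD (x y : R) : quotmod_pi (x + y) = quotmod_pi x + quotmod_pi y.
Proof. by rewrite /quotmod_pi !piE. Qed.

Fact quotmod_piK (u : quotmod) : quotmod_pi (repr u) = u.
Proof. exact: reprK. Qed.

Fact quotmod_scale_pi (a x : R) :
  quotmod_scale a (quotmod_pi x) = quotmod_pi (a * x).
Proof.
apply/eqP; rewrite quotmod_pi_eq -mulrBr; apply/asboolP.
have [_ _ IM] := idealP I; apply: IM; apply/asboolP.
have /eqP := quotmod_piK (quotmod_pi x).
by rewrite quotmod_pi_eq.
Qed.

Fact quotmod_scaleA a b (u : quotmod) :
  quotmod_scale a (quotmod_scale b u) = quotmod_scale (a * b) u.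
Proof. by rewrite -(quotmod_piK u) !quotmod_scale_pi mulrA. Qed.

Fact quotmod_scale1 : left_id 1 quotmod_scale.
Proof. by move=> u; rewrite -(quotmod_piK u) quotmod_scale_pi mul1r. Qed.

Fact quotmod_scaleDr : right_distributive quotmod_scale +%R.
Proof.
move=> a u v; rewrite -(quotmod_piK u) -(quotmod_piK v) -quotmod_piD.
by rewrite !quotmod_scale_pi -quotmod_piD mulrDr.
Qed.

Fact quotmod_scaleDl (u : quotmod) :
  {morph quotmod_scale^~ u : a b / a + b}.
Proof.
move=> a b; rewrite -(quotmod_piK u) !quotmod_scale_pi -quotmod_piD.
by rewrite mulrDl.
Qed.

HB.instance Definition _ := GRing.Zmodule_isLmodule.Build R quotmod
  quotmod_scaleA quotmod_scale1 quotmod_scaleDr quotmod_scaleDl.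

End QuotientModule.

Section Homological.
Variable R : comPzRingType.

(* Exact sequences ... -> P_2 -> P_1 -> P_0 -> M -> 0.                        *)
Record resolution (M : lmodType R) := Resolution {
  res_obj :> nat -> lmodType R;
  res_diff : forall n, {linear res_obj n.+1 -> res_obj n};
  res_aug : {linear res_obj 0 -> M};
  res_aug_surj : forall y, exists x, res_aug x = y;
  res_exact0 : forall x, res_aug x = 0 <-> exists z, res_diff 0 z = x;
  res_exactS : forall n x,
    res_diff n x = 0 <-> exists z, res_diff n.+1 z = x }.

Definition projective (P : lmodType R) :=
  forall (U W : lmodType R) (p : {linear U -> W}) (g : {linear P -> W}),
    (forall w, exists u, p u = w) ->
    exists h : {linear P -> U}, forall x, p (h x) = g x.

Definition cocycle (M N : lmodType R) (P : resolution M) n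
    (phi : {linear P n -> N}) :=
  forall x, phi (res_diff P n x) = 0.

Definition coboundary (M N : lmodType R) (P : resolution M) n :
    {linear P n -> N} -> Prop :=
  match n with
  | 0 => fun phi => forall x, phi x = 0
  | m.+1 => fun phi =>
      exists psi : {linear P m -> N}, forall x, phi x = psi (res_diff P m x)
  end.

(* Ext^n_R(M, N) = 0, i.e. H^n(Hom_R(P, N)) = 0 for the projective            *)
(* resolutions P of M (this group does not depend on the choice of P).        *)
Definition Ext_vanishes n (M N : lmodType R) :=
  forall P : resolution M, (forall i, projective (P i)) ->
  forall phi : {linear P n -> N}, cocycle phi -> coboundary phi.

Definition Q_torsion_free (N : lmodType R) :=
  forall (I : ideal R) (y : N), fg_semiregular I ->
    (forall a, ideal_set I a -> a *: y = 0) -> y = 0.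

Definition strongly_Lucas (N : lmodType R) :=
  Q_torsion_free N /\
  forall (I : ideal R) n, fg_semiregular I -> (1 <= n)%N ->
    Ext_vanishes n (quotmod I) N.

Definition tauq_projective (P : lmodType R) :=
  forall N : lmodType R, strongly_Lucas N -> Ext_vanishes 1 P N.

(* 0 -> P_n -> ... -> P_0 -> M -> 0 is a resolution with P_i = 0 for i > n.   *)
Definition tauq_resolution_length (M : lmodType R) n :=
  exists P : resolution M,
    (forall i, (i <= n)%N -> tauq_projective (P i)) /\
    (forall i, (n < i)%N -> forall x : P i, x = 0).

(* Dimensions take values in \bar int; the infimum of the empty set is +oo.   *)
Definition tauq_pd (M : lmodType R) : \bar int :=
  infimum +oo%E [set (n%:Z)%:E | n in tauq_resolution_length M].

Definition tauq_gldim : \bar int :=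
  supremum -oo%E [set d | exists M : lmodType R, d = tauq_pd M].

Definition tauq_semisimple := tauq_gldim = 0%E.

End Homological.

Section Amalgamation.
Variables (A B : comPzRingType) (f : {rmorphism A -> B}) (J : ideal B).

Definition amalg_set : set (A * B) :=
  [set x | exists a j, ideal_set J j /\ x = (a, f a + j)].

Definition amalg_pred : {pred A * B} := fun x => `[< amalg_set x >].

Fact amalg_subring_closed : subring_closed amalg_pred.
Proof.
have [J0 JD JM] := idealP J.
have JN x : ideal_set J x -> ideal_set J (- x) by rewrite -mulN1r; apply: JM.
split.
- by apply/asboolP; exists 1, 0; rewrite rmorph1 addr0.
- move=> _ _ /asboolP[a [j [Jj ->]]] /asboolP[b [k [Jk ->]]].
  apply/asboolP; exists (a - b), (j - k); split; first by apply: JD => //; apply: JN.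
  by congr (_, _); rewrite /= rmorphB opprD addrACA.
- move=> _ _ /asboolP[a [j [Jj ->]]] /asboolP[b [k [Jk ->]]].
  apply/asboolP; exists (a * b), (f a * k + j * (f b + k)); split.
    by apply: JD; [exact: JM|rewrite mulrC; exact: JM].
  by congr (_, _); rewrite /= rmorphM mulrDl mulrDr addrA.
Qed.

HB.instance Definition _ :=
  GRing.isSubringClosed.Build (A * B)%type amalg_pred amalg_subring_closed.

Definition amalg : Type := {x : A * B | amalg_pred x}.

HB.instance Definition _ :=
  SubChoice.copy amalg {x : A * B | amalg_pred x}.
HB.instance Definition _ := GRing.SubChoice_isSubComPzRing.Build (A * B)%type
  amalg_pred amalg amalg_subring_closed.

Definition prime_left (p : set A) : set amalg :=
  [set x | exists a j, [/\ p a, ideal_set J j & val x = (a, f a + j)]].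

Definition prime_right (q : set B) : set amalg := [set x | q (val x).2].

Definition ideal_add (q : set B) : set B := [set x + y | x in q & y in J].

Definition amalgX : set (set A) :=
  \bigcup_(q in Spec B `\` V J) V (f @^-1` ideal_add q).

End Amalgamation.
Arguments prime_left {A B} f J p _.
Arguments prime_right {A B} f J q _.

(* Main.v *)
(* A ring R is tau_q-semisimple iff it is reduced with finitely many minimal
   primes, and the minimal primes of the amalgamation are the p'^f and q-bar^f
   of the statement.

   If R is reduced with Min(R) finite, an ideal I + Ann(I) lies in no minimal
   prime, so it contains a finitely generated dense ideal; extending maps from
   that ideal shows that strongly Lucas modules satisfy Baer's criterion, hence
   are injective.

   Conversely let T be the product of the localizations R_m over the primes m
   that contain no finitely generated dense ideal. It is a faithful R-algebra in
   which every I in Q generates the unit ideal, so every ideal KT is strongly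
   Lucas. If it is injective, the map K -> KT is multiplication by some y in KT,
   and writing y = \sum k_i z_i shows that no nonzero x in K is killed by all the
   k_i. With K = aR and a^2 = 0 this gives reducedness; with K a minimal prime p
   it gives s outside p with s p = 0; with K the ideal of elements lying in all
   but finitely many minimal primes it gives the finiteness of Min(R). *)

Require Import Defs.
From HB Require Import structures.
From mathcomp Require Import all_boot all_order all_algebra.
From mathcomp Require Import generic_quotient.
From mathcomp Require Import boolp classical_sets cardinality fsbigop.
From mathcomp Require Import constructive_ereal.
From mathcomp Require Import ring.

Set Implicit Arguments.
Unset Strict Implicit.
Unset Printing Implicit Defensive.

Import Order.TTheory GRing.Theory Num.Theory.
Local Open Scope classical_set_scope.
Local Open Scope ring_scope.

(** * Submodules, products, free modules and resolutions *)

Section Modules.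
Variable R : comPzRingType.
Implicit Types M N U W : lmodType R.

Definition mk_linear U W (h : U -> W) (hL : linear h) : {linear U -> W} :=
  HB.pack h (GRing.isLinear.Build R U W *:%R h hL).

(** Closure is stated for a [Prop]-valued set, so that kernels and similar sets qualify directly;
    [asbool] then provides the boolean predicate that the subtype [submod] requires. *)
Record submodule M := Submodule {
  submodule_set :> set M;
  submodule0 : submodule_set 0;
  submoduleP : forall a x y,
    submodule_set x -> submodule_set y -> submodule_set (a *: x + y) }.

Definition submod_pred M (S : submodule M) : {pred M} :=
  fun x => `[< submodule_set S x >].

Fact submod_pred_closed M (S : submodule M) : submod_closed (submod_pred S).
Proof.
split=> [|a x y /asboolP Sx /asboolP Sy]; apply/asboolP.
  exact: submodule0.
exact: submoduleP.
Qed.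

HB.instance Definition _ M (S : submodule M) :=
  GRing.isSubmodClosed.Build R M (submod_pred S) (submod_pred_closed S).

Definition submod M (S : submodule M) : Type := {x : M | submod_pred S x}.

HB.instance Definition _ M (S : submodule M) :=
  SubChoice.copy (submod S) {x : M | submod_pred S x}.
HB.instance Definition _ M (S : submodule M) :=
  GRing.SubChoice_isSubLmodule.Build R M (submod_pred S) (submod S)
    (submod_pred_closed S).

Definition mk_submod M (S : submodule M) x (Sx : submodule_set S x) : submod S :=
  Sub x (asboolT Sx).

Lemma submod_valP M (S : submodule M) (x : submod S) : submodule_set S (val x).
Proof. exact: asboolW (valP x). Qed.

Lemma submod_val_inj M (S : submodule M) : injective (val : submod S -> M).
Proof. exact: val_inj. Qed.

Fact val_linear M (S : submodule M) : linear (val : submod S -> M).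
Proof. by move=> a x y; rewrite linearP. Qed.

Definition submod_val M (S : submodule M) : {linear submod S -> M} :=
  mk_linear (@val_linear M S).

Fact ker_linear0 U W (h : {linear U -> W}) : h 0 = 0.
Proof. exact: linear0. Qed.
Fact ker_linearP U W (h : {linear U -> W}) a x y :
  h x = 0 -> h y = 0 -> h (a *: x + y) = 0.
Proof. by move=> hx hy; rewrite linearP hx hy scaler0 addr0. Qed.
Definition lin_ker U W (h : {linear U -> W}) : submodule U :=
  @Submodule U [set x | h x = 0] (ker_linear0 h) (@ker_linearP U W h).

(** * Direct products of arbitrary families of modules *)

Section Product.
Variables (X : Type) (M : X -> lmodType R).
Definition dprod := forall i, M i.
Implicit Types u v w : dprod.
HB.instance Definition _ := gen_eqMixin dprod.
HB.instance Definition _ := gen_choiceMixin dprod.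
Definition dprod_add u v : dprod := fun i => u i + v i.
Definition dprod_opp u : dprod := fun i => - u i.
Definition dprod_scale a u : dprod := fun i => a *: u i.
Fact dprod_addA : associative dprod_add.
Proof. by move=> u v w; apply: functional_extensionality_dep => i; apply: addrA. Qed.
Fact dprod_addC : commutative dprod_add.
Proof. by move=> u v; apply: functional_extensionality_dep => i; apply: addrC. Qed.
Fact dprod_add0 : left_id (fun i => 0) dprod_add.
Proof. by move=> u; apply: functional_extensionality_dep => i; apply: add0r. Qed.
Fact dprod_addN : left_inverse (fun i => 0) dprod_opp dprod_add.
Proof. by move=> u; apply: functional_extensionality_dep => i; apply: addNr. Qed.
HB.instance Definition _ :=
  GRing.isZmodule.Build dprod dprod_addA dprod_addC dprod_add0 dprod_addN.
Fact dprod_scaleA a b u : dprod_scale a (dprod_scale b u) = dprod_scale (a * b) u.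
Proof. by apply: functional_extensionality_dep => i; apply: scalerA. Qed.
Fact dprod_scale1 : left_id 1 dprod_scale.
Proof. by move=> u; apply: functional_extensionality_dep => i; apply: scale1r. Qed.
Fact dprod_scaleDr : right_distributive dprod_scale +%R.
Proof. by move=> a u v; apply: functional_extensionality_dep => i; apply: scalerDr. Qed.
Fact dprod_scaleDl u : {morph dprod_scale^~ u : a b / a + b}.
Proof. by move=> a b; apply: functional_extensionality_dep => i; apply: scalerDl. Qed.
HB.instance Definition _ := GRing.Zmodule_isLmodule.Build R dprod
  dprod_scaleA dprod_scale1 dprod_scaleDr dprod_scaleDl.

Lemma dprodD u v i : (u + v) i = u i + v i. Proof. by []. Qed.
Lemma dprodZ a u i : (a *: u) i = a *: u i. Proof. by []. Qed.
Lemma dprod_sum (I : Type) (r : seq I) (F : I -> dprod) i :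
  (\sum_(k <- r) F k) i = \sum_(k <- r) F k i.
Proof. by elim/big_rec2: _ => // k u v _ <-. Qed.
End Product.

(** * Free modules as finitely supported functions *)

Section Free.
Variable X : choiceType.

Definition supported (s : seq X) (u : dprod (fun _ : X => R^o)) :=
  forall x, x \notin s -> u x = 0.

Fact fin_supp0 : exists s, supported s 0.
Proof. by exists [::]. Qed.

Fact fin_suppP a u v : (exists s, supported s u) -> (exists s, supported s v) ->
  exists s, supported s (a *: u + v).
Proof.
move=> [s us] [t vt]; exists (s ++ t) => x.
rewrite mem_cat negb_or => /andP[xs xt].
by rewrite dprodD dprodZ us // vt // scaler0 addr0.
Qed.

Definition fin_supp : submodule _ :=
  @Submodule (dprod (fun _ : X => R^o)) [set u | exists s, supported s u]
    fin_supp0 fin_suppP.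

Definition free := submod fin_supp.
HB.instance Definition _ := GRing.Lmodule.on free.

Definition coef (u : free) (x : X) : R := (val u : dprod (fun _ : X => R^o)) x.

Lemma coefP a (u v : free) x : coef (a *: u + v) x = a * coef u x + coef v x.
Proof. by []. Qed.

Lemma coef_sum (I : Type) (r : seq I) (c : I -> R) (F : I -> free) x :
  coef (\sum_(k <- r) c k *: F k) x = \sum_(k <- r) c k * coef (F k) x.
Proof. by elim/big_rec2: _ => // k u v _ <-. Qed.

Lemma coef_inj (u v : free) : coef u =1 coef v -> u = v.
Proof.
by move=> uv; apply: submod_val_inj; apply: functional_extensionality_dep.
Qed.

Lemma coef_supp (u : free) :
  exists2 s, uniq s & forall x, x \notin s -> coef u x = 0.
Proof.
have [s us] := submod_valP u; exists (undup s); first exact: undup_uniq.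
by move=> x; rewrite mem_undup; apply: us.
Qed.

(** A finitely supported sum over all of [X], so no support has to be chosen; [free_extE] computes
    it along any duplicate-free list containing the support of [u]. *)
Definition free_ext W (v : X -> W) (u : free) : W :=
  \sum_(x \in setT) (coef u x *: v x).

Lemma free_extE W (v : X -> W) (u : free) s :
  uniq s -> (forall x, x \notin s -> coef u x = 0) ->
  free_ext v u = \sum_(x <- s) coef u x *: v x.
Proof.
move=> us uz; rewrite /free_ext -(fsbig_widen [set` s]) //=; last first.
  by move=> x [_ /= /negP xs]; rewrite uz // scale0r.
by rewrite -fsbig_seq.
Qed.

Fact free_ext_linear W (v : X -> W) : linear (free_ext v).
Proof.
move=> a u w; have [s us su] := coef_supp u; have [t ut tw] := coef_supp w.
pose r := undup (s ++ t).
have ru x : x \notin r -> coef u x = 0.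
  by rewrite mem_undup mem_cat negb_or => /andP[xs _]; apply: su.
have rw x : x \notin r -> coef w x = 0.
  by rewrite mem_undup mem_cat negb_or => /andP[_ xt]; apply: tw.
rewrite !(@free_extE _ _ _ r) ?undup_uniq //; last first.
  by move=> x xr; rewrite coefP ru // rw // mulr0 addr0.
rewrite scaler_sumr -big_split /=.
by apply: eq_bigr => x _; rewrite coefP scalerDl scalerA.
Qed.

Definition free_map W (v : X -> W) : {linear free -> W} :=
  mk_linear (free_ext_linear v).

Fact delta_fin_supp (x : X) : submodule_set fin_supp (fun y => (y == x)%:R).
Proof. by exists [:: x] => y; rewrite inE => /negPf ->. Qed.

Definition delta x : free := mk_submod (delta_fin_supp x).

Lemma coef_delta x y : coef (delta x) y = (y == x)%:R.
Proof. by []. Qed.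

Lemma free_map_delta W (v : X -> W) x : free_map v (delta x) = v x.
Proof.
rewrite /= (@free_extE _ _ _ [:: x]) //; last first.
  by move=> y; rewrite inE coef_delta => /negPf ->.
by rewrite big_seq1 coef_delta eqxx scale1r.
Qed.

Lemma free_decomp (u : free) : free_map delta u = u.
Proof.
have [s us su] := coef_supp u.
rewrite /= (free_extE _ us su); apply: coef_inj => y; rewrite coef_sum.
under eq_bigr => x _ do rewrite coef_delta.
have [ys|ys] := boolP (y \in s).
  rewrite (bigD1_seq y) //= eqxx big1 ?addr0 ?mulr1 //.
  by move=> x; rewrite eq_sym => /negPf ->; rewrite mulr0.
rewrite big1_seq ?su // => x /andP[_ xs].
by rewrite (_ : y == x = false) ?mulr0 //; apply: contraNF ys => /eqP ->.
Qed.

Lemma free_projective : projective free.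
Proof.
move=> U W p g pS; have [v pv] := choice (fun x => pS (g (delta x))).
exists (free_map v) => u; rewrite -[in RHS](free_decomp u) /=.
have [s us su] := coef_supp u; rewrite !(free_extE _ us su) !linear_sum.
by apply: eq_bigr => x _; rewrite !linearZ /= pv.
Qed.
End Free.

(** Taking all elements of [U] as generators makes the construction canonical, so it iterates:
    covering each successive kernel and including it in the previous free module yields a free
    resolution. *)
Definition cover (U : lmodType R) : {linear free U -> U} :=
  free_map (fun x : U => x).
Definition syzygy (U : lmodType R) : lmodType R := submod (lin_ker (cover U)).
Definition cover_step U : {linear free (syzygy U) -> free U} :=
  @submod_val _ (lin_ker (cover U)) \o cover (syzygy U).

Lemma cover_surj U (y : U) : exists x, cover U x = y.
Proof. by exists (delta y); apply: free_map_delta. Qed.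

Lemma cover_exact U x : cover U x = 0 <-> exists z, cover_step U z = x.
Proof.
split=> [kx|[z <-]]; last exact: (submod_valP (cover (syzygy U) z)).
have [z zE] := cover_surj (mk_submod (S := lin_ker (cover U)) kx).
by exists z; apply: (congr1 val zE).
Qed.

Lemma cover_step_exact U x :
  cover_step U x = 0 <-> exists z, cover_step (syzygy U) z = x.
Proof.
rewrite -cover_exact; split=> [x0|x0].
  by apply: submod_val_inj; rewrite [LHS]x0 linear0.
by rewrite [LHS](congr1 val x0) linear0.
Qed.

(** * A free resolution of R/I beginning with R *)

Section IdealResolution.
Variable I : ideal R.

Fact ideal_submoduleP (a : R) (x y : R^o) :
  ideal_set I x -> ideal_set I y -> ideal_set I (a *: x + y).
Proof. by have [_ ID IM] := idealP I => Ix Iy; apply: ID => //; apply: IM. Qed.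
Fact ideal_submodule0 : ideal_set I (0 : R^o).
Proof. by have [] := idealP I. Qed.
Definition ideal_submodule : submodule R^o :=
  Submodule ideal_submodule0 ideal_submoduleP.
Definition ideal_mod : lmodType R := submod ideal_submodule.

Fact quotmod_pi_linear : linear (quotmod_pi I : R^o -> quotmod I).
Proof.
by move=> a x y; rewrite quotmod_piD -quotmod_scale_pi.
Qed.

(** [Ext_vanishes] quantifies over projective resolutions, so a concrete one is needed to exploit
    it. Degree 0 is R, and degree m+1 is the free cover of the m-th syzygy of [I]. *)
Definition quot_obj n : lmodType R :=
  if n is m.+1 then free (iter m syzygy ideal_mod) else R^o.
Definition quot_diff n : {linear quot_obj n.+1 -> quot_obj n} :=
  match n with
  | 0 => submod_val ideal_submodule \o cover ideal_mod
  | m.+1 => cover_step (iter m syzygy ideal_mod)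
  end.

Fact quot_aug_surj (y : quotmod I) : exists x, mk_linear quotmod_pi_linear x = y.
Proof. by exists (generic_quotient.repr y); apply: quotmod_piK. Qed.

Fact quot_exact0 x :
  mk_linear quotmod_pi_linear x = 0 <-> exists z, quot_diff 0 z = x.
Proof.
have pi0 : quotmod_pi I x = 0 <-> ideal_set I x.
  rewrite -[0](linear0 (mk_linear quotmod_pi_linear)) /=.
  by rewrite (rwP eqP) quotmod_pi_eq subr0; split=> /asboolP.
rewrite [X in X <-> _]pi0; split=> [Ix|[z <-]].
  have [z zE] := cover_surj (mk_submod (S := ideal_submodule) Ix).
  by exists z; apply: (congr1 val zE).
exact: (submod_valP (cover ideal_mod z)).
Qed.

Fact quot_exactS n x :
  quot_diff n x = 0 <-> exists z, quot_diff n.+1 z = x.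
Proof.
case: n x => [|n] x; last exact: cover_step_exact.
rewrite -cover_exact; split=> [x0|x0].
  by apply: submod_val_inj; rewrite [LHS]x0 linear0.
by rewrite [LHS](congr1 val x0) linear0.
Qed.

Definition quot_resolution : resolution (quotmod I) :=
  Resolution quot_aug_surj quot_exact0 quot_exactS.

Lemma regular_projective : projective (R^o : lmodType R).
Proof.
move=> U W p g pS; have [u pu] := pS (g 1).
have hL : linear (fun x : R^o => x *: u).
  by move=> a x y; rewrite scalerDl -scalerA.
exists (mk_linear hL) => x /=.
by rewrite linearZ /= pu -linearZ; congr (g _); apply: mulr1.
Qed.

Lemma quot_resolution_projective n : projective (quot_resolution n).
Proof. by case: n => [|n]; [apply: regular_projective|apply: free_projective]. Qed.

End IdealResolution.

(** A homomorphism I -> N, represented by a function on all of R whose values outside [I] are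
    arbitrary. *)
Definition ideal_hom (I : set R) N (g : R -> N) :=
  (forall x y, I x -> I y -> g (x + y) = g x + g y) /\
  (forall a x, I x -> g (a * x) = a *: g x).

Definition baer_injective N := forall (I : ideal R) g, ideal_hom I g ->
  exists n : N, forall x, ideal_set I x -> g x = x *: n.

(** Composed with the free cover of [I], the map [g] becomes a 1-cocycle. It is therefore induced by
    some psi : R -> N, and n = psi(1). *)
Lemma Ext1_quot_extend (I : ideal R) N (g : R -> N) :
  Ext_vanishes 1 (quotmod I) N -> ideal_hom I g ->
  exists n, forall x, ideal_set I x -> g x = x *: n.
Proof.
move=> ext [gD gM].
have gL : linear (fun x : ideal_mod I => g (val x)).
  move=> a x y; have Ix := submod_valP x; have Iy := submod_valP y.
  have [_ _ IM] := idealP I.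
  by rewrite linearP /= gD ?gM //; apply: IM.
pose phi : {linear quot_resolution I 1 -> N} :=
  mk_linear gL \o cover (ideal_mod I).
have [|psi psiE] := ext _ (@quot_resolution_projective I) phi.
  move=> x; have x0 : cover (ideal_mod I) (quot_diff I 1 x) = 0.
    by apply/cover_exact; exists x.
  exact: etrans (congr1 (mk_linear gL) x0) (linear0 _).
exists (psi 1) => x Ix.
have [z zE] := cover_surj (mk_submod (S := ideal_submodule I) Ix).
have := etrans (esym (congr1 (mk_linear gL) zE)) (psiE z) => /= ->.
have -> : \val (free_ext id z) = x :> R^o := congr1 val zE.
by rewrite -linearZ; congr (psi _); rewrite [RHS]mulr1.
Qed.

End Modules.

(** * Vanishing of Ext and tau_q-dimension *)

(** Zorn's lemma is applied to the sets S whose union with [S0] satisfies [P]. Only nonempty chains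
    are assumed to have their union in [P]; the empty chain is settled by [S0] itself. *)
Lemma zorn_above (T : Type) (P : set (set T)) (S0 : set T) : P S0 ->
  (forall F : set (set T), F !=set0 -> F `<=` P -> total_on F subset ->
    P (\bigcup_(S in F) S)) ->
  exists S, [/\ P S, S0 `<=` S & forall S', P S' -> S `<=` S' -> S' = S].
Proof.
move=> PS0 Pchain.
have [F FP Ftot|S [PS Smax]] := @Zorn_bigcup T [set S | P (S0 `|` S)].
  have [->|/set0P[S1 FS1]] := eqVneq F set0; first by rewrite bigcup_set0 /= setU0.
  rewrite /=.
  suff -> : S0 `|` \bigcup_(S in F) S = \bigcup_(S in [set S0 `|` S | S in F]) S.
    apply: Pchain; first by exists (S0 `|` S1), S1.
      by move=> _ [S FS <-]; apply: FP.
    move=> _ _ [S FS <-] [S' FS' <-].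
    by have [SS|SS] := Ftot _ _ FS FS'; [left|right]; apply: setUS.
  rewrite eqEsubset; split=> x.
    move=> [S0x|[S FS Sx]]; last by exists (S0 `|` S); [exists S|right].
    by exists (S0 `|` S1); [exists S1|left].
  by move=> [_ [S FS <-] [S0x|Sx]]; [left|right; exists S].
exists (S0 `|` S); split=> // S' PS' SS'.
apply: contrapT => S'N; apply: (Smax S'); last first.
  by rewrite /= (iffRL (setUidPr _ _)) // => x S0x; apply: SS'; left.
split=> [x Sx|S'S]; first by apply: SS'; right.
by apply: S'N; rewrite eqEsubset; split=> // x /S'S; right.
Qed.

Section Homology.
Variable R : comPzRingType.
Implicit Types M N U W : lmodType R.

(** Baer's argument, carried out on graphs of partial maps W -> N. The kernel condition makes the
    pairs (d z, phi z) the graph of a map on the image of [d], and a maximal graph above it is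
    total. *)
Lemma baer_extend N U W (d : {linear U -> W}) (phi : {linear U -> N}) :
  baer_injective N -> (forall z, d z = 0 -> phi z = 0) ->
  exists psi : {linear W -> N}, forall z, phi z = psi (d z).
Proof.
move=> bN ker_phi.
(* The graph of a linear map on a submodule of [W]; by linearity, single-valuedness need only be
   asked at 0. *)
pose good (G : set (W * N)) := [/\ G (0, 0),
  forall a x u y v, G (x, u) -> G (y, v) -> G (a *: x + y, a *: u + v)
  & forall u, G (0, u) -> u = 0].
have [||G [[G0 GP Gfun] sub Gmax]] :=
  @zorn_above _ good [set p | exists z, p = (d z, phi z)].
- split; first by exists 0; rewrite !linear0.
    by move=> a _ _ _ _ [z [-> ->]] [t [-> ->]]; exists (a *: z + t); rewrite !linearP.
  by move=> _ [z [/esym dz ->]]; apply: ker_phi.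
- move=> F [S FS] FP Ftot; split.
  + by exists S => //; have [] := FP _ FS.
  + move=> a x u y v [S1 FS1 S1x] [S2 FS2 S2y].
    have [SS|SS] := Ftot _ _ FS1 FS2.
      by exists S2 => //; have [_ + _] := FP _ FS2; apply => //; apply: SS.
    by exists S1 => //; have [_ + _] := FP _ FS1; apply => //; apply: SS.
  + by move=> u [S1 FS1 S1u]; have [_ _] := FP _ FS1; apply.
have Guniq x u v : G (x, u) -> G (x, v) -> u = v.
  move=> Gu Gv; apply/esym/subr0_eq/Gfun.
  by have := GP (-1) _ _ _ _ Gu Gv; rewrite !scaleN1r addNr addrC.
have GD x u y v : G (x, u) -> G (y, v) -> G (x + y, u + v).
  by move=> Gx Gy; have := GP 1 _ _ _ _ Gx Gy; rewrite !scale1r.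
have GZ a x u : G (x, u) -> G (a *: x, a *: u).
  by move=> Gx; have := GP a _ _ _ _ Gx G0; rewrite !addr0.
have Gtot x : exists u, G (x, u).
  (* The ideal of scalars that bring [x] into the domain of [G]; on it [G] induces a homomorphism to
     [N]. *)
  pose D : set R := [set r | exists u, G (r *: x, u)].
  have D_ideal : is_ideal D.
    split; first by exists 0; rewrite scale0r.
      by move=> r s [u Gu] [v Gv]; exists (u + v); rewrite scalerDl; apply: GD.
    by move=> a r [u Gu]; exists (a *: u); rewrite -scalerA; apply: GZ.
  have /choice[g gG] : forall r, exists u, D r -> G (r *: x, u).
    move=> r; have [[u Gu]|nDr] := pselect (D r); first by exists u.
    by exists 0.
  have [|n0 gE] := bN (Ideal D_ideal) g.
    have [_ DD DM] := D_ideal.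
    split=> [r s Dr Ds|a r Dr].
      apply: Guniq (gG _ (DD _ _ Dr Ds)) _.
      by rewrite scalerDl; apply: GD; apply: gG.
    by apply: Guniq (gG _ (DM _ _ Dr)) _; rewrite -scalerA; apply: GZ; apply: gG.
  (* Adjoin [x] with value [n0]. If u + r x = 0 with u in the domain, then -r lies in [D], where
     multiplication by [n0] agrees with [G]; so the result is again a graph. *)
  pose G' := [set p | exists u v r, G (u, v) /\ p = (u + r *: x, v + r *: n0)].
  exists n0; rewrite -(Gmax G'); first by exists 0, 0, 1; rewrite !add0r !scale1r.
    split.
    + by exists 0, 0, 0; rewrite !scale0r !addr0.
    + move=> a _ _ _ _ [u [v [r [Gu [-> ->]]]]] [u' [v' [r' [Gu' [-> ->]]]]].
      exists (a *: u + u'), (a *: v + v'), (a * r + r'); split; first exact: GP.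
      by rewrite !scalerDr !scalerDl !scalerA; congr (_, _); apply: addrACA.
    + move=> _ [u [v [r [Gu [/esym/eqP + ->]]]]].
      rewrite addr_eq0 -scaleNr => /eqP uE.
      have Dr : D (- r) by exists v; rewrite -uE.
      rewrite uE in Gu.
      by rewrite (Guniq _ _ _ Gu (gG _ Dr)) gE // scaleNr addNr.
  by move=> [u v] Gu; exists u, v, 0; rewrite !scale0r !addr0.
have [psi psiG] := choice Gtot.
have psiL : linear psi.
  by move=> a x y; apply: Guniq (psiG _) _; apply: GP.
exists (mk_linear psiL) => z.
by apply: Guniq (psiG _); apply: sub; exists z.
Qed.

Lemma baer_Ext1 M N : baer_injective N -> Ext_vanishes 1 M N.
Proof.
move=> bN P _ phi coc; apply: baer_extend bN _ => z.
by move/res_exactS => [t <-].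
Qed.

(** Projectivity lifts along surjections only, so [p] is restricted to a map from the kernel of q p
    onto the kernel of q, through which [g] factors. *)
Lemma projective_lift (P U W Z : lmodType R)
    (p : {linear U -> W}) (q : {linear W -> Z}) (g : {linear P -> W}) :
  projective P -> (forall w, q w = 0 -> exists u, p u = w) ->
  (forall x, q (g x) = 0) -> exists h : {linear P -> U}, forall x, p (h x) = g x.
Proof.
move=> projP ex qg; pose K := lin_ker q.
pose S0 : submodule U := lin_ker (q \o p).
have pL : linear (fun u : submod S0 => mk_submod (S := K) (submod_valP u)).
  move=> a u v; apply: submod_val_inj.
  exact: (linearP p a (val u) (val v)).
have gL : linear (fun x => mk_submod (S := K) (qg x)).
  by move=> a u v; apply: submod_val_inj; apply: (linearP g).
have [|h hE] := projP _ _ (mk_linear pL) (mk_linear gL).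
  move=> w; have [u uE] := ex _ (submod_valP w).
  have qu : submodule_set S0 u by rewrite /= uE; apply: (submod_valP w).
  by exists (mk_submod (S := S0) qu); apply: submod_val_inj; rewrite /= uE.
by exists (submod_val S0 \o h) => x; have /= := congr1 val (hE x).
Qed.

Lemma res_diff_diff M (P : resolution M) n x :
  res_diff P n (res_diff P n.+1 x) = 0.
Proof. by apply/res_exactS; exists x. Qed.

Lemma scale_linear M (a : R) : linear (fun x : M => a *: x).
Proof. by move=> b x y; rewrite scalerDr !scalerA [a * b]mulrC. Qed.

(** Of the homotopy relation only d h d = a d is recorded. It says that a x - h(d x) is a cycle, and
    lifting this cycle through the next differential gives the next [h]. *)
Lemma mul_nullhomotopic M (P : resolution M) (a : R) :
  (forall i, projective (P i)) -> (forall y : M, a *: y = 0) ->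
  forall n, exists h : {linear P n -> P n.+1},
    forall z, res_diff P n (h (res_diff P n z)) = a *: res_diff P n z.
Proof.
move=> projP aM0; elim=> [|n [h hE]].
  have [||h hE] := @projective_lift _ _ _ _ (res_diff P 0) (res_aug P)
    (mk_linear (@scale_linear (P 0) a)) (projP 0).
  - by move=> w /res_exact0.
  - by move=> x; rewrite /= linearZ; apply: aM0.
  by exists h => z; rewrite hE.
have gL : linear (fun x => a *: x - h (res_diff P n x)).
  move=> b x y; rewrite (linearP (res_diff P n)) (linearP h).
  by rewrite scalerDr scalerBr !scalerA [b * a]mulrC opprD addrACA.
have [||h' h'E] := @projective_lift _ _ _ _ (res_diff P n.+1) (res_diff P n)
    (mk_linear gL) (projP n.+1).
- by move=> w /res_exactS.
- by move=> x; rewrite /= linearB hE linearZ subrr.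
by exists h' => z; rewrite h'E /= res_diff_diff linear0 subr0.
Qed.

(* Each [a] in [I] kills [R/I], hence is null-homotopic on its resolutions, so
   multiplication by [a] kills Ext^n(R/I, N); the [t i] make [I] act on [N] as
   the unit ideal. *)
Lemma strongly_Lucas_of_unit_ideals N :
  (forall I : ideal R, fg_semiregular I ->
    exists n (a : 'I_n -> R) (t : 'I_n -> {linear N -> N}),
      (forall i, ideal_set I (a i)) /\ forall y, \sum_i t i (a i *: y) = y) ->
  strongly_Lucas N.
Proof.
move=> unitN; split=> [I y|I [//|m]] /unitN[n [a [t [Ia tE]]]] => [Iy|_].
  by rewrite -[LHS]tE big1 // => i _; rewrite Iy // linear0.
move=> P projP phi coc.
have aM0 i (y : quotmod I) : a i *: y = 0.
  have [_ _ IM] := idealP I.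
  rewrite -(quotmod_piK y); apply: etrans (quotmod_scale_pi _ _ _) _.
  rewrite -[RHS](linear0 (mk_linear (@quotmod_pi_linear R I))); apply/eqP.
  by rewrite quotmod_pi_eq subr0; apply/asboolP; rewrite mulrC; apply: IM.
have [h hE] := choice (fun i => mul_nullhomotopic projP (aM0 i) m).
(* Since a_i x and h_i(d x) differ by a boundary, which [phi] kills, the identity y = sum of t_i(a_i
   y) at y = phi(x) dictates this primitive of [phi]. *)
have psiL : linear (fun x => \sum_i t i (phi (h i x))).
  move=> b x y; rewrite scaler_sumr -big_split; apply: eq_bigr => i _ /=.
  by rewrite !linearP.
exists (mk_linear psiL) => x /=.
rewrite -[LHS]tE; apply: eq_bigr => i _; congr (t i _).
have /res_exactS[z zE] : res_diff P m (a i *: x - h i (res_diff P m x)) = 0.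
  by rewrite linearB hE linearZ subrr.
by apply/eqP; rewrite -linearZ -subr_eq0 -linearB -zE coc.
Qed.

Lemma linear_bij_inverse U W (d : {linear U -> W}) :
  (forall y, exists x, d x = y) -> (forall x, d x = 0 -> x = 0) ->
  exists d' : {linear W -> U}, cancel d d' /\ cancel d' d.
Proof.
move=> /choice[d' dK] d_inj.
have inj : injective d.
  by move=> x y xy; apply/subr0_eq/d_inj; rewrite linearB xy subrr.
have d'L : linear d' by move=> a x y; apply: inj; rewrite linearP !dK.
by exists (mk_linear d'L); split=> x //=; apply: inj; rewrite dK.
Qed.

(** Composing the augmentation of a resolution of [M] with the inverse of [d] gives a resolution of
    [P] with the same terms and differentials, hence the same cocycles and coboundaries. *)
Lemma tauq_projective_iso (M P : lmodType R) (d : {linear P -> M}) :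
  (forall y, exists x, d x = y) -> (forall x, d x = 0 -> x = 0) ->
  tauq_projective P -> tauq_projective M.
Proof.
move=> dS dI projP N NL Q projQ.
have [d' [dK d'K]] := linear_bij_inverse dS dI.
have augS y : exists x, (d' \o res_aug Q) x = y.
  by have [x xE] := res_aug_surj Q (d y); exists x; rewrite /= xE dK.
have ex0 x : (d' \o res_aug Q) x = 0 <-> exists z, res_diff Q 0 z = x.
  rewrite -res_exact0 /=; split=> [x0|->]; last exact: linear0.
  by rewrite -[LHS]d'K x0 linear0.
exact: projP _ NL (Resolution augS ex0 (@res_exactS _ _ Q)) projQ.
Qed.

(** * Resolutions of length zero and the tau_q-dimension *)

Section TrivialResolution.
Variable M : lmodType R.

Definition zero_submodule : submodule M := lin_ker (idfun : {linear M -> M}).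
Definition triv_obj n : lmodType R :=
  if n is _.+1 then submod zero_submodule else M.
Definition triv_diff n : {linear triv_obj n.+1 -> triv_obj n} := \0.

Lemma triv_obj0 n (x : triv_obj n.+1) : x = 0.
Proof. by apply: submod_val_inj; rewrite linear0; apply: (submod_valP x). Qed.

Fact triv_aug_surj (y : M) : exists x, (idfun : {linear M -> M}) x = y.
Proof. by exists y. Qed.
Fact triv_exact0 x :
  (idfun : {linear M -> M}) x = 0 <-> exists z, triv_diff 0 z = x.
Proof. by split=> [x0|[z <-]//]; exists 0; rewrite [RHS]x0. Qed.
Fact triv_exactS n x : triv_diff n x = 0 <-> exists z, triv_diff n.+1 z = x.
Proof. by split=> // _; exists 0; rewrite [RHS]triv_obj0 linear0. Qed.

Definition triv_resolution : resolution M :=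
  Resolution triv_aug_surj triv_exact0 triv_exactS.
End TrivialResolution.

(** When P_1 = 0, exactness makes the augmentation P_0 -> M an isomorphism. *)
Lemma tauq_resolution_length0 M :
  tauq_resolution_length M 0 <-> tauq_projective M.
Proof.
split=> [[P [projP P0]]|projM].
  apply: (tauq_projective_iso (res_aug_surj P)) (projP 0 isT) => x.
  by move/res_exact0 => [z <-]; rewrite (P0 1%N isT z) linear0.
exists (triv_resolution M); split=> [[|//] _|[//|i] _ x]; first exact: projM.
exact: triv_obj0.
Qed.

Lemma infimum_min d (T : porderType d) (x0 x : T) (A : set T) :
  A x -> lbound A x -> infimum x0 A = x.
Proof.
move=> Ax lAx; rewrite /infimum ifF; last first.
  by apply/negP => /eqP A0; rewrite A0 in Ax.
have Ix : infimums A x by split=> // y; apply.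
exact: (is_subset1_infimums (xgetPex x0 (ex_intro _ x Ix)) Ix).
Qed.

Lemma tauq_pd_ge0 M : (0 <= tauq_pd M)%E.
Proof.
rewrite /tauq_pd /infimum; case: ifPn => [_|/set0P S0]; first exact: leey.
set A := infimums _; case: (xgetP +oo%E A) => [x _ [_ glb]|_]; last exact: leey.
by apply: glb => _ [n _ <-].
Qed.

Lemma tauq_pd_le0 M : (tauq_pd M <= 0)%E <-> tauq_projective M.
Proof.
rewrite -tauq_resolution_length0 /tauq_pd; split=> [|S0]; last first.
  rewrite (@infimum_min _ _ _ 0%E) //; first by exists 0%N.
  by move=> _ [n _ <-].
have [/asboolP S0|/asboolP nS] := boolP `[< exists n, tauq_resolution_length M n >].
  have {}S0 : exists n, `[< tauq_resolution_length M n >].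
    by case: S0 => n Sn; exists n; apply/asboolP.
  (* By well-ordering the infimum is attained at the least length, so being at most 0 forces that
     length to be 0. *)
  case: (ex_minnP S0) => n /asboolP Sn nmin.
  rewrite (@infimum_min _ _ _ (n%:Z)%:E) ?lee_fin ?lez_nat ?leqn0.
  - by move=> /eqP n0; rewrite -n0.
  - by exists n.
  - by move=> _ [m /asboolP/nmin nm <-]; rewrite lee_fin lez_nat.
have -> : [set (n%:Z)%:E | n in tauq_resolution_length M] = set0 :> set (\bar int).
  by apply/seteqP; split=> // x [n Sn _]; apply: nS; exists n.
by rewrite /infimum eqxx leNgt ltey.
Qed.

Lemma tauq_semisimpleP :
  tauq_semisimple R <-> forall M : lmodType R, tauq_projective M.
Proof.
rewrite /tauq_semisimple /tauq_gldim; set A := [set d | _].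
have AM (M : lmodType R) : A (tauq_pd M) by exists M.
split=> [|projM]; last first.
  rewrite (_ : A = [set 0%E]) ?supremum1 //; apply/seteqP; split=> [_ [M ->]|_ ->] /=.
    by apply/eqP; rewrite eq_le tauq_pd_ge0 andbT; apply/tauq_pd_le0.
  exists R^o; apply/eqP; rewrite eq_le tauq_pd_ge0 /=; exact/tauq_pd_le0.
(* The value 0 differs from the default -oo, so it is a genuine supremum and bounds every
   dimension. *)
rewrite /supremum; case: ifP => // _.
case: (xgetP -oo%E (supremums A)) => // x _ [ub _] x0 M.
by apply/tauq_pd_le0; rewrite -x0; apply: ub.
Qed.

End Homology.

(** * Minimal primes, primes avoiding dense ideals, localization *)

Section MinimalPrimes.
Variable R : comPzRingType.
Implicit Types (p S : set R).

Lemma spec_ideal p : Spec R p -> is_ideal p. Proof. by case. Qed.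

Lemma prime_exp p x n : Spec R p -> p (x ^+ n) -> p x.
Proof.
move=> [_ p1 pM]; elim: n => [|n IHn]; first by rewrite expr0.
by rewrite exprS => /pM[].
Qed.

Definition mul_closed S := [/\ S 1, forall x y, S x -> S y -> S (x * y) & ~ S 0].

Lemma mul_closed_powers S x : S 1 -> (forall y z, S y -> S z -> S (y * z)) ->
  (forall s n, S s -> s * x ^+ n <> 0) ->
  mul_closed [set s * x ^+ n | s in S & n in setT].
Proof.
move=> S1 SM Sx; split; first by exists 1 => //; exists 0%N; rewrite ?mulr1.
- move=> _ _ [s Ss [n _ <-]] [t St [m _ <-]].
  by exists (s * t); [exact: SM|exists (n + m)%N; rewrite // exprD mulrACA].
- by move=> [s Ss [n _ sx]]; apply: (Sx s n).
Qed.

(* The complement of a maximal multiplicative set avoiding 0 is a minimal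
   prime: by maximality each [a] outside has [s * a ^+ n = 0] with [s] inside. *)
Lemma minimal_prime_avoiding S : mul_closed S ->
  exists2 p, Min R p & forall x, S x -> ~ p x.
Proof.
move=> SP; have [||M [[M1 MM M0] SM Mmax]] := @zorn_above _ mul_closed S => //.
  move=> F [S1 FS1] FP Ftot; split.
  - by exists S1 => //; have [] := FP _ FS1.
  - move=> x y [A FA Ax] [B FB By].
    have [AB|BA] := Ftot _ _ FA FB.
      by exists B => //; have [_ + _] := FP _ FB; apply => //; apply: AB.
    by exists A => //; have [_ + _] := FP _ FA; apply => //; apply: BA.
  - by move=> [A FA A0]; have [_ _] := FP _ FA.
have ann a : ~ M a -> exists s n, M s /\ s * a ^+ n = 0.
  move=> nMa; apply: contrapT => nS; apply: nMa.
  rewrite -(Mmax [set s * a ^+ n | s in M & n in setT]).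
  - by exists 1 => //; exists 1%N => //; rewrite mul1r.
  - by apply: mul_closed_powers => // s n Ms sa; apply: nS; exists s, n.
  - by move=> s Ms; exists s => //; exists 0%N => //; rewrite mulr1.
have Mann s a n : M s -> s * a ^+ n = 0 -> ~ M a.
  move=> Ms sa Ma; apply: M0; rewrite -sa; apply: (MM _ _ Ms).
  by elim: n {sa} => // n IH; rewrite exprS; apply: MM.
have pP : Spec R (~` M).
  split; [split=> //| |].
  - move=> x y /ann[s [n [Ms sx]]] /ann[t [m [Mt ty]]].
    apply: (Mann (s * t) _ (n + m)%N); first exact: MM.
    (* In the binomial expansion of (x + y)^(n + m) every term is divisible by x^n or by y^m. *)
    rewrite exprDn mulr_sumr big1 // => i _; rewrite -mulrnAr.
    have [im|mi] := leqP m i.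
      by rewrite -(subnK im) exprD; ring: ty.
    rewrite (_ : n + m - i = (m - i) + n)%N; last first.
      by rewrite -addnBA ?(ltnW mi) // addnC.
    by rewrite exprD; ring: sx.
  - move=> a x /ann[s [n [Ms sx]]]; apply: (Mann s _ n) => //.
    by rewrite exprMn mulrCA sx mulr0.
  - by move/(_ M1).
  - move=> x y nxy; apply: contrapT => /not_orP[/contrapT Mx /contrapT My].
    by apply: nxy; apply: MM.
exists (~` M); last by move=> x /SM Mx /(_ Mx).
split=> // p' p'P p'M; rewrite eqEsubset; split=> // a /ann[s [n [Ms sa]]].
have [[p'0 _ _] _ p'mul] := p'P.
have /p'mul[/p'M/(_ Ms)//|] : p' (s * a ^+ n) by rewrite sa.
exact: prime_exp.
Qed.

(** Otherwise the products s x^n with s outside [p] form a multiplicative set avoiding 0, and a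
    prime avoiding it is contained in [p] but misses [x], against minimality. *)
Lemma minimal_prime_ann p x : Min R p -> p x ->
  exists s n, ~ p s /\ s * x ^+ n = 0.
Proof.
move=> [pS pmin] px; apply: contrapT => nS.
have [[p0 pD pM] p1 pmul] := pS.
have [|q [qS _] qE] :=
  @minimal_prime_avoiding [set s * x ^+ n | s in ~` p & n in setT].
  apply: mul_closed_powers => //.
    by move=> y z py pz /pmul[].
  by move=> s n ps sx; apply: nS; exists s, n.
have qp : q `<=` p.
  move=> y qy; apply: contrapT => py; apply: (qE y) => //.
  by exists y => //; exists 0%N => //; rewrite mulr1.
apply: (qE x); last by rewrite (pmin _ qS qp).
by exists 1 => //; exists 1%N => //; rewrite mul1r.
Qed.

Lemma reduced_exp (x : R) n : reduced R -> x ^+ n = 0 -> x = 0.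
Proof.
by move=> rR xn; have : nilradical R x by [exists n]; rewrite rR.
Qed.

Lemma reduced_sqr (x : R) : reduced R -> x * x = 0 -> x = 0.
Proof. by move=> rR xx; apply: (@reduced_exp x 2). Qed.

Lemma reduced_minimal_prime_ann p x : reduced R -> Min R p -> p x ->
  exists2 s, ~ p s & s * x = 0.
Proof.
move=> rR pM px; have [s [n [ps sx]]] := minimal_prime_ann pM px.
exists s => //; apply: (@reduced_exp _ n.+1) => //.
by rewrite exprMn exprS exprSr mulrACA sx mul0r.
Qed.

(** In a reduced ring the powers of a nonzero [x] avoid 0, so some minimal prime misses them. *)
Lemma reduced_minimal_primes_eq0 x : reduced R ->
  (forall p, Min R p -> p x) -> x = 0.
Proof.
move=> rR xp; apply: contrapT => x0.
have [|p pM /(_ x)] :=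
  @minimal_prime_avoiding [set s * x ^+ n | s in [set 1] & n in setT].
  apply: mul_closed_powers => // [y z -> ->|s n ->]; first by rewrite /= mulr1.
  by rewrite mul1r => /(reduced_exp rR).
apply; last exact: xp.
by exists 1 => //; exists 1%N; rewrite // mul1r.
Qed.

End MinimalPrimes.

(** * Primes containing no finitely generated dense ideal *)

Section AvoidingPrimes.
Variable R : comPzRingType.

Definition dense_seq (s : seq R) :=
  forall r, (forall x, x \in s -> x * r = 0) -> r = 0.

(** For an ideal this means containing no finitely generated dense ideal; the form with finite lists
    passes at once to unions of chains. *)
Definition avoids_dense (I : set R) :=
  forall s, dense_seq s -> exists2 x, x \in s & ~ I x.

Lemma chain_seq (T : eqType) (F : set (set T)) (s : seq T) :
  F !=set0 -> total_on F subset -> (forall x, x \in s -> (\bigcup_(S in F) S) x) ->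
  exists2 S, F S & forall x, x \in s -> S x.
Proof.
move=> [S0 FS0] Ftot; elim: s => [|y s IHs] Fs; first by exists S0.
have [S FS sS] : exists2 S, F S & forall x, x \in s -> S x.
  by apply: IHs => x xs; apply: Fs; rewrite inE xs orbT.
have [S' FS' S'y] := Fs y (mem_head _ _).
have [SS|SS] := Ftot _ _ FS FS'.
  by exists S' => // x; rewrite inE => /predU1P[->//|/sS]; apply: SS.
by exists S => // x; rewrite inE => /predU1P[->|/sS//]; apply: SS.
Qed.

(** An ideal M maximal with [avoids_dense] above Ann(a) is prime: for x, y outside M, both M + Rx
    and M + Ry contain dense lists, and the pairwise products form a dense list inside M + Rxy. *)
Lemma avoiding_prime (a : R) : a <> 0 ->
  exists p, [/\ Spec R p, avoids_dense p & forall x, x * a = 0 -> p x].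
Proof.
move=> a0; have [||M [[[M0 MD MM] Mav] aM Mmax]] :=
  @zorn_above _ [set I | is_ideal I /\ avoids_dense I] [set x | x * a = 0].
- split.
    split; first by rewrite /= mul0r.
      by move=> x y xa ya; rewrite /= mulrDl xa ya addr0.
    by move=> b x xa; rewrite /= -mulrA xa mulr0.
  move=> s sd; apply: contrapT => nS; apply: a0; apply: sd => x xs.
  by apply: contrapT => xa; apply: nS; exists x.
- move=> F [I1 FI1] FP Ftot; split; last first.
    move=> s sd; apply: contrapT => nS.
    have [||I FI sI] := @chain_seq _ F s _ Ftot; first by exists I1.
      by move=> x xs; apply: contrapT => nx; apply: nS; exists x.
    have [_ /(_ s sd)[x xs]] := FP _ FI.
    by apply; apply: sI.
  split.
  + by exists I1 => //; have [[]] := FP _ FI1.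
  + move=> x y [I FI Ix] [I' FI' I'y].
    have [II|II] := Ftot _ _ FI FI'.
      by exists I' => //; have [[_ + _] _] := FP _ FI'; apply => //; apply: II.
    by exists I => //; have [[_ + _] _] := FP _ FI; apply => //; apply: II.
  + by move=> b x [I FI Ix]; exists I => //; have [[_ _ +] _] := FP _ FI; apply.
exists M; split=> //; split=> //.
  move=> M1; have [|x] := Mav [:: 1].
    by move=> r /(_ 1 (mem_head _ _)); rewrite mul1r.
  by rewrite inE => /eqP ->.
have ext x : ~ M x -> exists2 s, dense_seq s &
    forall z, z \in s -> exists u r, M u /\ z = u + r * x.
  move=> nMx; apply: contrapT => nS; apply: nMx.
  rewrite -(Mmax [set z | exists u r, M u /\ z = u + r * x]).
  - by exists 0, 1; rewrite add0r mul1r.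
  - split; first split.
    + by exists 0, 0; rewrite mul0r addr0.
    + move=> _ _ [u [r [Mu ->]]] [v [t [Mv ->]]]; exists (u + v), (r + t).
      by split; [exact: MD|ring].
    + move=> b _ [u [r [Mu ->]]]; exists (b * u), (b * r).
      by split; [exact: MM|ring].
    move=> s sd; apply: contrapT => nx; apply: nS; exists s => // z zs.
    by apply: contrapT => nz; apply: nx; exists z.
  - by move=> u Mu; exists u, 0; rewrite mul0r addr0.
move=> x y Mxy; apply: contrapT => /not_orP[/ext[s sd sE] /ext[t td tE]].
have [|z] := Mav [seq u * v | u <- s, v <- t].
  move=> r rE; apply: sd => u us; apply: td => v vt.
  by rewrite mulrA [v * u]mulrC; apply: rE; apply/allpairsP; exists (u, v).
move=> /allpairsP[[u v] /= [/sE[u1 [r [Mu1 ->]]] /tE[v1 [q [Mv1 ->]]] ->]]; apply.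
rewrite (_ : _ * _ = (v1 + q * y) * u1 + ((r * x) * v1 + (r * q) * (x * y))); last by ring.
by apply: (MD); [|apply: MD]; apply: MM.
Qed.

End AvoidingPrimes.

(** * Localization at a prime, as an R-module *)

Section Localization.
Variables (R : comPzRingType) (p : set R).
Hypothesis pP : Spec R p.

Definition loc_den := {s : R | `[< ~ p s >]}.
Definition loc_pair := (R * loc_den)%type.
Implicit Types x y z : loc_pair.

Lemma denP (s : loc_den) : ~ p (val s).
Proof. exact: asboolW (valP s). Qed.

Arguments denP : clear implicits.

Lemma denM s t : ~ p s -> ~ p t -> ~ p (s * t).
Proof. by have [_ _ pM] := pP => ps pt /pM[]. Qed.

Lemma den1 : ~ p 1. Proof. by have [] := pP. Qed.

Definition mk_den s (ps : ~ p s) : loc_den := exist _ s (asboolT ps).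

Definition loc_rel x y :=
  `[< exists2 u, ~ p u & u * (x.1 * val y.2 - y.1 * val x.2) = 0 >].

Fact loc_rel_refl : reflexive loc_rel.
Proof. by move=> x; apply/asboolP; exists 1; [exact: den1|rewrite subrr mulr0]. Qed.

Fact loc_rel_sym : symmetric loc_rel.
Proof.
suff sub x y : loc_rel x y -> loc_rel y x.
  by move=> x y; apply/idP/idP; apply: sub.
move=> /asboolP[u pu uE]; apply/asboolP; exists u => //.
by rewrite -opprB mulrN uE oppr0.
Qed.

Fact loc_rel_trans : transitive loc_rel.
Proof.
move=> y x z /asboolP[u pu uE] /asboolP[v pv vE]; apply/asboolP.
(* The denominator of the middle fraction is included so that the two given relations can be
   combined. *)
exists (val y.2 * (u * v)); first by apply: denM; [exact: denP|exact: denM].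
rewrite (_ : _ * _ = v * val z.2 * (u * (x.1 * val y.2 - y.1 * val x.2)) +
  u * val x.2 * (v * (y.1 * val z.2 - z.1 * val y.2))); last by ring.
by rewrite uE vE !mulr0 addr0.
Qed.

Canonical loc_equiv := EquivRel loc_rel loc_rel_refl loc_rel_sym loc_rel_trans.

Local Open Scope quotient_scope.

Definition loc := {eq_quot loc_equiv}.
HB.instance Definition _ := Choice.on loc.
HB.instance Definition _ := EqQuotient.on loc.

Definition loc_pi (x : loc_pair) : loc := \pi_loc x.

Lemma loc_piP x y : reflect
  (exists2 u, ~ p u & u * (x.1 * val y.2 - y.1 * val x.2) = 0)
  (loc_pi x == loc_pi y).
Proof. by rewrite eqmodE; apply: asboolP. Qed.

Lemma loc_pi_eq x y : x.1 * val y.2 = y.1 * val x.2 -> loc_pi x = loc_pi y.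
Proof.
move=> xy; apply/eqP/loc_piP; exists 1; first exact: den1.
by rewrite xy subrr mulr0.
Qed.

Lemma loc_piK (a : loc) : loc_pi (repr a) = a. Proof. exact: reprK. Qed.

Lemma loc_repr x : exists2 u, ~ p u &
  u * ((repr (loc_pi x)).1 * val x.2 - x.1 * val (repr (loc_pi x)).2) = 0.
Proof. by apply/loc_piP; rewrite loc_piK. Qed.

Definition addp x y : loc_pair :=
  (x.1 * val y.2 + y.1 * val x.2, mk_den (denM (denP x.2) (denP y.2))).
Definition loc_add (a b : loc) := loc_pi (addp (repr a) (repr b)).
Definition loc_opp (a : loc) := loc_pi (- (repr a).1, (repr a).2).
Definition loc_scale r (a : loc) := loc_pi (r * (repr a).1, (repr a).2).
Definition loc_zero := loc_pi (0, mk_den den1).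

Lemma loc_addE x y : loc_add (loc_pi x) (loc_pi y) = loc_pi (addp x y).
Proof.
have [u pu] := loc_repr x; have [v pv] := loc_repr y; rewrite /loc_add.
move: (repr (loc_pi x)) (repr (loc_pi y)) => x' y' vE uE.
apply/eqP/loc_piP; exists (u * v); first exact: denM.
rewrite (_ : _ * _ = v * val y.2 * val y'.2 * (u * (x'.1 * val x.2 - x.1 * val x'.2)) +
  u * val x.2 * val x'.2 * (v * (y'.1 * val y.2 - y.1 * val y'.2))); last first.
  by rewrite /=; ring.
by rewrite uE vE !mulr0 addr0.
Qed.

Lemma loc_oppE x : loc_opp (loc_pi x) = loc_pi (- x.1, x.2).
Proof.
have [u pu] := loc_repr x; rewrite /loc_opp; move: (repr _) => x' /= uE.
apply/eqP/loc_piP; exists u => //=.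
by rewrite -[RHS]oppr0 -uE; ring.
Qed.

Lemma loc_scaleE r x : loc_scale r (loc_pi x) = loc_pi (r * x.1, x.2).
Proof.
have [u pu] := loc_repr x; rewrite /loc_scale; move: (repr _) => x' /= uE.
apply/eqP/loc_piP; exists u => //=.
by rewrite -[RHS](mulr0 r) -uE; ring.
Qed.

Fact loc_addA : associative loc_add.
Proof.
move=> a b c; rewrite -(loc_piK a) -(loc_piK b) -(loc_piK c) !loc_addE.
by apply: loc_pi_eq => /=; ring.
Qed.
Fact loc_addC : commutative loc_add.
Proof.
move=> a b; rewrite -(loc_piK a) -(loc_piK b) !loc_addE.
by apply: loc_pi_eq => /=; ring.
Qed.
Fact loc_add0 : left_id loc_zero loc_add.
Proof.
by move=> a; rewrite -(loc_piK a) loc_addE; apply: loc_pi_eq => /=; ring.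
Qed.
Fact loc_addN : left_inverse loc_zero loc_opp loc_add.
Proof.
move=> a; rewrite -(loc_piK a) loc_oppE loc_addE.
by apply: loc_pi_eq => /=; ring.
Qed.
HB.instance Definition _ :=
  GRing.isZmodule.Build loc loc_addA loc_addC loc_add0 loc_addN.

Lemma loc_piD x y : loc_pi x + loc_pi y = loc_pi (addp x y).
Proof. exact: loc_addE. Qed.

Fact loc_scaleA r s a : loc_scale r (loc_scale s a) = loc_scale (r * s) a.
Proof. by rewrite -(loc_piK a) !loc_scaleE mulrA. Qed.
Fact loc_scale1 : left_id 1 loc_scale.
Proof. by move=> a; rewrite -(loc_piK a) loc_scaleE; apply: loc_pi_eq => /=; ring. Qed.
Fact loc_scaleDr : right_distributive loc_scale +%R.
Proof.
move=> r a b; rewrite -(loc_piK a) -(loc_piK b) loc_piD !loc_scaleE.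
by rewrite loc_piD; apply: loc_pi_eq => /=; ring.
Qed.
Fact loc_scaleDl a : {morph loc_scale^~ a : r s / r + s}.
Proof.
move=> r s; rewrite -(loc_piK a) !loc_scaleE loc_piD.
by apply: loc_pi_eq => /=; ring.
Qed.
HB.instance Definition _ := GRing.Zmodule_isLmodule.Build R loc
  loc_scaleA loc_scale1 loc_scaleDr loc_scaleDl.

Lemma loc_piZ r x : r *: loc_pi x = loc_pi (r * x.1, x.2).
Proof. exact: loc_scaleE. Qed.

Definition loc1 : loc := loc_pi (1, mk_den den1).

Lemma loc_scale_eq0 r : r *: loc1 = 0 -> exists2 u, ~ p u & u * r = 0.
Proof.
move=> r0; have /eqP/loc_piP[u pu uE] := etrans (esym (loc_piZ r _)) r0.
by exists u => //; rewrite -uE /=; ring.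
Qed.

Lemma loc_inverse s : ~ p s ->
  exists t : {linear loc -> loc}, forall y : loc, t (s *: y) = y.
Proof.
move=> ps; pose divp x : loc_pair := (x.1, mk_den (denM ps (denP x.2))).
have divE x : loc_pi (divp (repr (loc_pi x))) = loc_pi (divp x).
  have [u pu] := loc_repr x; move: (repr _) => x' /= uE.
  apply/eqP/loc_piP; exists u => //=.
  by rewrite -[RHS](mulr0 s) -uE; ring.
have divL : linear (fun a : loc => loc_pi (divp (repr a))).
  move=> r a b; rewrite -(loc_piK a) -(loc_piK b).
  rewrite loc_piZ loc_piD !divE loc_piZ loc_piD.
  by apply: loc_pi_eq => /=; ring.
exists (mk_linear divL) => y; rewrite -(loc_piK y) /=.
rewrite loc_piZ divE.
by apply: loc_pi_eq => /=; ring.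
Qed.

End Localization.

(** * tau_q-semisimple rings are reduced with finitely many minimal primes *)

Section Semisimple.
Variable R : comPzRingType.

Definition dense_family n (g : 'I_n -> R) :=
  forall r, (forall i, g i * r = 0) -> r = 0.

Lemma dense_family_seq n (g : 'I_n -> R) :
  dense_family g -> dense_seq [seq g i | i <- enum 'I_n].
Proof.
move=> gd r rE; apply: gd => i; apply: rE.
by apply: map_f; rewrite mem_enum.
Qed.

Lemma fg_semiregular_dense (I : ideal R) : fg_semiregular I ->
  exists n (g : 'I_n -> R), (forall i, ideal_set I (g i)) /\ dense_family g.
Proof.
move=> [[n [g Ig]] [D [_ _ Dd DI]]]; exists n, g; split.
  move=> i; rewrite Ig; exists (fun j => (j == i)%:R).
  rewrite (bigD1 i) //= eqxx mul1r big1 ?addr0 // => j /negPf ->.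
  by rewrite mul0r.
move=> r rE; apply: Dd => x /DI; rewrite Ig => -[c ->].
by rewrite mulr_suml big1 // => i _; rewrite -mulrA rE mulr0.
Qed.

(** [e] has 1 in every component. For r nonzero some prime of the family contains Ann(r), and r
    stays nonzero in that localization, whence faithfulness. *)
Lemma faithful_unit_module : exists (T : lmodType R) (e : T),
  (forall r, r *: e = 0 -> r = 0) /\
  forall n (g : 'I_n -> R), dense_family g ->
    exists t : 'I_n -> {linear T -> T}, forall y, \sum_i t i (g i *: y) = y.
Proof.
pose X := {p : set R | Spec R p /\ avoids_dense p}.
pose pS (p : X) : Spec R (sval p) := (svalP p).1.
pose T : lmodType R := dprod (fun p : X => loc (pS p)).
pose e : T := fun p => loc1 (pS p).
exists T, e; split=> [r r0|n g /dense_family_seq gd].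
  apply: contrapT => /avoiding_prime[p [pP pav rp]].
  pose q : X := exist _ p (conj pP pav).
  have [u pu ur] : exists2 u, ~ p u & u * r = 0.
    by apply: (@loc_scale_eq0 _ _ (pS q)); have := congr1 (fun y : T => y q) r0.
  exact/pu/rp.
have /choice[i ip] : forall p : X, exists i, ~ sval p (g i).
  move=> p; have [_ /mapP[i _ ->] pi] := (svalP p).2 _ gd.
  by exists i.
pose s p : {linear loc (pS p) -> loc (pS p)} :=
  projT1 (cid (loc_inverse (pS p) (ip p))).
have sE p y : s p (g (i p) *: y) = y.
  by rewrite /s; case: cid.
(* [i p] selects a member of [g] outside [p]. The map [t k] divides by [g k] in the components with
   i p = k and is 0 in the others, so each component of the sum receives a single contribution. *)
pose t k (y : T) : T := fun p => if i p == k then s p (y p) else 0.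
have tL k : linear (t k).
  move=> a y z; apply: functional_extensionality_dep => p.
  rewrite [RHS]dprodD dprodZ /t; case: eqP => _; last by rewrite scaler0 addr0.
  by rewrite dprodD dprodZ linearP.
exists (fun k => mk_linear (tL k)) => y.
apply: functional_extensionality_dep => p; rewrite dprod_sum.
rewrite (bigD1 (i p)) //= {1}/t eqxx dprodZ sE big1 ?addr0 // => k.
by rewrite eq_sym /t => /negPf ->.
Qed.

(** * The submodule KT generated by the multiples of T by an ideal K *)

Section IdealMultiple.
Variables (T : lmodType R) (K : ideal R).

(** The sum is kept as a list of pairs because its coefficients form the finite family extracted in
    [semisimple_fin_subfamily]. *)
Definition in_KT (y : T) := exists2 s : seq (R * T),
  forall c, c \in s -> ideal_set K c.1 & y = \sum_(c <- s) c.1 *: c.2.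

Fact in_KT0 : in_KT 0.
Proof. by exists [::]; rewrite ?big_nil. Qed.

Fact in_KTP a y z : in_KT y -> in_KT z -> in_KT (a *: y + z).
Proof.
move=> [s sK ->] [t tK ->]; exists ([seq (c.1, a *: c.2) | c <- s] ++ t).
  by move=> c; rewrite mem_cat => /orP[/mapP[d /sK Kd ->]|/tK].
rewrite big_cat big_map scaler_sumr; congr (_ + _).
by apply: eq_bigr => c _; rewrite !scalerA mulrC.
Qed.

Definition KT : submodule T := @Submodule _ T in_KT in_KT0 in_KTP.

Lemma in_KT_linear (t : {linear T -> T}) y : in_KT y -> in_KT (t y).
Proof.
move=> [s sK ->]; exists [seq (c.1, t c.2) | c <- s].
  by move=> c /mapP[d /sK Kd ->].
by rewrite linear_sum big_map; apply: eq_bigr => c _; rewrite linearZ.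
Qed.
End IdealMultiple.

(** Ext^1(R/K, KT) = 0 turns x -> x e into multiplication by some y = sum of k_i z_i. If every k_i
    kills x in K, then x e = x y = 0, and x = 0 by faithfulness. *)
Lemma semisimple_fin_subfamily (K : ideal R) :
  (forall M : lmodType R, tauq_projective M) ->
  exists2 s : seq R, forall k, k \in s -> ideal_set K k &
    forall x, ideal_set K x -> (forall k, k \in s -> k * x = 0) -> x = 0.
Proof.
move=> projM; have [T [e [e_inj Tunit]]] := faithful_unit_module.
have NL : strongly_Lucas (submod (KT T K)).
  apply: strongly_Lucas_of_unit_ideals => I /fg_semiregular_dense[n [g [Ig gd]]].
  have [t tE] := Tunit n g gd.
  pose t' i (y : submod (KT T K)) : submod (KT T K) :=
    mk_submod (S := KT T K) (in_KT_linear (t i) (submod_valP y)).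
  have t'L i : linear (t' i).
    by move=> a y z; apply: submod_val_inj; apply: (linearP (t i)).
  exists n, g, (fun i => mk_linear (t'L i)); split=> // y.
  apply: submod_val_inj; rewrite (linear_sum (submod_val _)) -[RHS]tE.
  by apply: eq_bigr.
have eK x : ideal_set K x -> in_KT K (x *: e).
  by move=> Kx; exists [:: (x, e)]; rewrite ?big_seq1 // => c; rewrite inE => /eqP ->.
have /choice[g gE] : forall x, exists y : submod (KT T K),
    ideal_set K x -> val y = x *: e.
  move=> x; have [Kx|nKx] := pselect (ideal_set K x); last by exists 0.
  by exists (mk_submod (S := KT T K) (eK x Kx)).
have [K0 KD KM] := idealP K.
have gh : ideal_hom (ideal_set K) g.
  split=> [x y Kx Ky|a x Kx]; apply: submod_val_inj.
    rewrite gE; last exact: KD.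
    by rewrite linearD /= !gE // scalerDl.
  rewrite gE; last exact: KM.
  by rewrite linearZ /= gE // scalerA.
have [y yE] := Ext1_quot_extend (projM (quotmod K) _ NL) gh.
have [s sK sE] := submod_valP y.
exists [seq c.1 | c <- s] => [k /mapP[c /sK Kc -> //]|x Kx xs].
apply: e_inj; rewrite -gE // yE // linearZ /= [X in _ *: X]sE scaler_sumr.
rewrite big1_seq // => c /andP[_ cs].
by rewrite scalerA mulrC xs ?scale0r //; apply: map_f.
Qed.

Lemma principal_is_ideal (a : R) : is_ideal [set x | exists r, x = r * a].
Proof.
split; first by exists 0; rewrite mul0r.
  by move=> _ _ [r ->] [s ->]; exists (r + s); rewrite mulrDl.
by move=> b _ [r ->]; exists (b * r); rewrite mulrA.
Qed.

Lemma semisimple_reduced :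
  (forall M : lmodType R, tauq_projective M) -> reduced R.
Proof.
move=> projM.
have sqr0 (a : R) : a * a = 0 -> a = 0.
  move=> aa; have [s sK] := semisimple_fin_subfamily (Ideal (principal_is_ideal a)) projM.
  apply; first by exists 1; rewrite mul1r.
  by move=> k /sK[r ->]; rewrite -mulrA aa mulr0.
rewrite /reduced eqEsubset; split=> [x [n]|_ ->]; last by exists 1%N.
(* The exponent descends: x^(n+2) = 0 makes the square of x^(n+1) vanish. *)
elim/ltn_ind: n => -[_|[_|n IH xn]]; [|by []|].
  by rewrite expr0 => /(congr1 ( *%R x)); rewrite mulr1 mulr0.
apply: (IH n.+1) => //; apply: sqr0.
by rewrite -exprD addnS -addSn exprD xn mul0r.
Qed.

Lemma semisimple_finite_Min :
  (forall M : lmodType R, tauq_projective M) -> finite_set (Min R).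
Proof.
move=> projM; have rR := semisimple_reduced projM.
(* A product of annihilators gives [u] outside [p] killing the finite family attached to [p]; then
   each u x with x in [p] is killed by that family, hence is 0. *)
have isolated p : Min R p -> exists2 s, ~ p s & forall x, p x -> s * x = 0.
  move=> pM; have [pS _] := pM.
  have [s sp sE] := semisimple_fin_subfamily (Ideal (spec_ideal pS)) projM.
  have [u pu uE] : exists2 u, ~ p u & forall k, k \in s -> u * k = 0.
    elim: s sp {sE} => [|k s IHs] sp; first by exists 1 => //; have [] := pS.
    have [u pu us] : exists2 u, ~ p u & forall k, k \in s -> u * k = 0.
      by apply: IHs => x xs; apply: sp; rewrite inE xs orbT.
    have [v pv vk] := reduced_minimal_prime_ann rR pM (sp k (mem_head _ _)).
    exists (u * v); first by have [_ _ pmul] := pS; move=> /pmul[].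
    move=> x; rewrite inE => /predU1P[->|/us ux].
      by rewrite -mulrA vk mulr0.
    by rewrite mulrAC ux mul0r.
  exists u => // x px; have [_ _ pm] := spec_ideal pS.
  apply: sE; first exact: pm.
  by move=> k /uE uk; rewrite mulrA [k * u]mulrC uk mul0r.
have K_ideal : is_ideal [set x | finite_set [set p | Min R p /\ ~ p x]].
  split.
  - by rewrite /= (_ : [set _ | _] = set0) //; apply/seteqP; split=> // p [[[[]]]].
  - move=> x y xf yf.
    have := conj xf yf; rewrite -finite_setU; apply: sub_finite_set => p [pM pxy].
    have [_ pD _] := spec_ideal pM.1.
    apply: contrapT => /not_orP[].
    move=> /not_andP[//|/contrapT px] /not_andP[//|/contrapT py].
    exact/pxy/pD.
  - move=> a x; apply: sub_finite_set => p [pM pax]; split=> // px; apply: pax.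
    by have [_ _ +] := spec_ideal pM.1; apply.
have [s sK sE] := semisimple_fin_subfamily (Ideal K_ideal) projM.
(* Each minimal [p] misses some member of [s]. Otherwise take the [u] isolating [p]: any minimal
   prime missing [u] contains [p], so equals it, and thus [u] lies in the ideal; but [s] kills [u],
   so u = 0, which is in [p]. *)
apply: (@sub_finite_set _ _ (\bigcup_(k in [set` s]) [set p | Min R p /\ ~ p k])).
  move=> p pM; apply: contrapT => ps.
  have {}ps k : k \in s -> p k.
    by move=> ks; apply: contrapT => pk; apply: ps; exists k.
  have [u pu uE] := isolated p pM; apply: pu; rewrite (sE u) //.
  - by have [] := spec_ideal pM.1.
  - apply: (@sub_finite_set _ _ [set p]) => // q [qM qu].
    rewrite /= [RHS](qM.2 p pM.1) // => x px.
    have [[q0 _ _] _ qmul] := qM.1.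
    by have /qmul[] : q (u * x) by rewrite uE.
  - by move=> k /ps pk; rewrite mulrC uE.
apply: bigcup_finite; first exact: finite_seq.
by move=> k /sK.
Qed.

End Semisimple.

(** * Reduced rings with finitely many minimal primes *)

Section FinitelyManyMinimalPrimes.
Variable R : comPzRingType.

Definition span n (g : 'I_n -> R) : set R :=
  [set x | exists c : 'I_n -> R, x = \sum_i c i * g i].

Lemma span_is_ideal n (g : 'I_n -> R) : is_ideal (span g).
Proof.
split.
- by exists (fun=> 0); rewrite big1 // => i _; rewrite mul0r.
- move=> _ _ [c ->] [d ->]; exists (fun i => c i + d i).
  by rewrite -big_split; apply: eq_bigr => i _; rewrite mulrDl.
- move=> a _ [c ->]; exists (fun i => a * c i).
  by rewrite mulr_sumr; apply: eq_bigr => i _; rewrite mulrA.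
Qed.

Lemma mem_span n (g : 'I_n -> R) i : span g (g i).
Proof.
exists (fun j => (j == i)%:R).
rewrite (bigD1 i) //= eqxx mul1r big1 ?addr0 // => j /negPf ->.
by rewrite mul0r.
Qed.

Lemma span_sub n (g : 'I_n -> R) I : is_ideal I -> (forall i, I (g i)) -> span g `<=` I.
Proof.
move=> [I0 ID IM] Ig _ [c ->].
by elim/big_ind: _ => // i _; apply: IM.
Qed.

Lemma prime_avoid_others (ps : seq (set R)) p : Spec R p ->
  (forall q, q \in ps -> is_ideal q /\ exists2 x, q x & ~ p x) ->
  exists2 r, ~ p r & forall q, q \in ps -> q r.
Proof.
move=> [pI p1 pmul]; elim: ps => [|q ps IHps] psE; first by exists 1.
have [r pr rE] : exists2 r, ~ p r & forall q, q \in ps -> q r.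
  by apply: IHps => q' qps; apply: psE; rewrite inE qps orbT.
have [[_ _ qM] [x qx px]] := psE q (mem_head _ _).
exists (r * x); first by move=> /pmul[].
move=> q'; rewrite inE => /predU1P[->|q'ps]; first exact: qM.
have [|[_ _ q'M] _] := psE q'; first by rewrite inE q'ps orbT.
by rewrite mulrC; apply: q'M; apply: (rE q').
Qed.

Hypotheses (rR : reduced R) (finR : finite_set (Min R)).

(** Take r outside [p] and in all the other minimal primes. If D were inside [p], then D r would lie
    in every minimal prime, so D r = 0 and r = 0 by density. *)
Lemma dense_not_sub_minimal D p : dense D -> Min R p -> ~ D `<=` p.
Proof.
move=> Dd pM Dp; have /finite_seqP[ps psE] := finR.
have [|r pr rE] := @prime_avoid_others [seq q <- ps | q != p] p pM.1.
  move=> q; rewrite mem_filter => /andP[/eqP qp qps].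
  have qM : Min R q by rewrite psE.
  split; first exact: spec_ideal qM.1.
  apply: contrapT => nq; apply: qp; apply: pM.2 => [|x qx]; first exact: qM.1.
  by apply: contrapT => px; apply: nq; exists x.
apply: pr; rewrite (Dd r); first by have [[]] := pM.1.
move=> x Dx; apply: (reduced_minimal_primes_eq0 rR) => q qM.
have [[_ _ qmul] _ _] := qM.1.
have [->|qp] := eqVneq q p.
  by have [[_ _ pmul] _ _] := pM.1; rewrite mulrC; apply: pmul; apply: Dp.
apply: qmul; apply: (rE q); rewrite mem_filter qp /=.
by move: qM; rewrite psE.
Qed.

(** Choose in D one element outside each of the finitely many minimal primes. Whatever they all kill
    lies in every minimal prime, so is 0. *)
Lemma dense_semiregular D : is_ideal D -> dense D ->
  exists I : ideal R, fg_semiregular I /\ ideal_set I `<=` D.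
Proof.
move=> DI Dd; have /finite_seqP[ps psE] := finR.
have [t tD tE] : exists2 t : seq R, (forall x, x \in t -> D x) &
    forall p, p \in ps -> exists2 x, x \in t & ~ p x.
  have : forall p, p \in ps -> Min R p by rewrite psE.
  elim: (ps) => [|p qs IHqs] psM; first by exists [::].
  have [t tD tE] : exists2 t : seq R, (forall x, x \in t -> D x) &
      forall p, p \in qs -> exists2 x, x \in t & ~ p x.
    by apply: IHqs => q qqs; apply: psM; rewrite inE qqs orbT.
  have [x Dx px] : exists2 x, D x & ~ p x.
    apply: contrapT => nx; apply: (dense_not_sub_minimal Dd (psM p (mem_head _ _))).
    by move=> x Dx; apply: contrapT => px; apply: nx; exists x.
  exists (x :: t) => [y|q]; rewrite inE => /predU1P[->|].
  - by [].
  - exact: tD.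
  - by exists x; rewrite ?mem_head.
  - by move=> /tE[y yt qy]; exists y; rewrite // inE yt orbT.
pose g (i : 'I_(size t)) := t`_i.
have gd : dense (span g).
  move=> r rE; apply: (reduced_minimal_primes_eq0 rR) => p pM.
  have [|x xt px] := tE p; first by move: pM; rewrite psE.
  have xr : x * r = 0.
    have ti : (index x t < size t)%N by rewrite index_mem.
    by have := rE _ (mem_span g (Ordinal ti)); rewrite /g /= nth_index.
  have [[p0 _ _] _ pmul] := pM.1.
  by have /pmul[] : p (x * r) by rewrite xr.
exists (Ideal (span_is_ideal g)); split; last first.
  by apply: span_sub => // i; apply: tD; apply: mem_nth.
have gfg : fin_generated (span g) by exists (size t), g.
by split=> //; exists (span g); split=> //; apply: span_is_ideal.
Qed.

(* [I + Ann I] is dense because [R] is reduced; a homomorphism on [I], extended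
   by 0 on [Ann I], extends to [R] from a finitely generated dense ideal inside. *)
Lemma strongly_Lucas_baer (N : lmodType R) : strongly_Lucas N -> baer_injective N.
Proof.
move=> [tfN extN] I g [gD gM].
have [I0 ID IM] := idealP I.
pose ann y := forall z, ideal_set I z -> z * y = 0.
pose D := [set d | exists2 x, ideal_set I x & ann (d - x)].
have DI : is_ideal D.
  split.
  - by exists 0 => // z _; rewrite subr0 mulr0.
  - move=> d d' [x Ix dx] [x' Ix' dx']; exists (x + x'); first exact: ID.
    by move=> z Iz; rewrite opprD addrACA mulrDr dx // dx' // addr0.
  - move=> a d [x Ix dx]; exists (a * x); first exact: IM.
    by move=> z Iz; rewrite -mulrBr mulrCA dx // mulr0.
have Dd : dense D.
  move=> r rD; have annr : ann r.
    by move=> z Iz; apply: rD; exists z => // w _; rewrite subrr mulr0.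
  by apply: (reduced_sqr rR); apply: rD; exists 0 => //; rewrite subr0.
(* [pr] is the projection of I + Ann I onto [I], with arbitrary values off [D]. It is unique because
   an element of both [I] and Ann I has square 0. *)
have /choice[pr prE] : forall d, exists x, D d -> ideal_set I x /\ ann (d - x).
  move=> d; have [[x Ix dx]|nD] := pselect (D d); first by exists x.
  by exists 0.
have prU d x : D d -> ideal_set I x -> ann (d - x) -> pr d = x.
  move=> /prE[Ip dp] Ix dx; apply/subr0_eq/(reduced_sqr rR).
  have Ipx : ideal_set I (pr d - x) by apply: ID => //; rewrite -mulN1r; apply: IM.
  rewrite {2}(_ : pr d - x = (d - x) - (d - pr d)); last by ring.
  by rewrite mulrBr dx // dp // subrr.
have [K [Kfg KD]] := dense_semiregular DI Dd.
have [K0 KDD KM] := idealP K.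
have [||n nE] := @Ext1_quot_extend _ K N (g \o pr); first exact: extN.
  split=> [d d' Kd Kd'|a d Kd] /=.
    have [Id dI] := prE d (KD _ Kd); have [Id' dI'] := prE d' (KD _ Kd').
    rewrite (prU _ (pr d + pr d')) ?gD //; [exact/KD/KDD|exact: ID|].
    by move=> z Iz; rewrite opprD addrACA mulrDr dI // dI' // addr0.
  have [Id dI] := prE d (KD _ Kd).
  rewrite (prU _ (a * pr d)) ?gM //; [exact/KD/KM|exact: IM|].
  by move=> z Iz; rewrite -mulrBr mulrCA dI // mulr0.
(* For d in [K], d y = y pr(d) gives d g(y) = y g(pr d) = y d n. So [K] kills g(y) - y n, and
   torsion-freeness concludes. *)
exists n => y Iy; apply/subr0_eq/(tfN K) => // d Kd.
have [Id dI] := prE d (KD _ Kd).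
have dy : d * y = y * pr d.
  by apply/subr0_eq; rewrite -(dI y Iy); ring.
have gpr : g (pr d) = d *: n := nE d Kd.
by rewrite scalerBr -gM // dy gM // gpr !scalerA mulrC subrr.
Qed.

End FinitelyManyMinimalPrimes.

(** * Primes of the amalgamation *)

(** Reduces the theorem to computing the nilpotents and the minimal primes of the amalgamation. *)
Lemma tauq_semisimple_reduced_finite_Min (R : comPzRingType) :
  tauq_semisimple R <-> reduced R /\ finite_set (Min R).
Proof.
rewrite tauq_semisimpleP; split=> [projM|[rR finR] M N NL].
  by split; [exact: semisimple_reduced|exact: semisimple_finite_Min].
exact/baer_Ext1/strongly_Lucas_baer.
Qed.

Section AmalgamPrimes.
Variables (A B : comPzRingType) (f : {rmorphism A -> B}) (J : ideal B).
Local Notation C := (amalg f J).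

Let J0 : ideal_set J 0. Proof. by have [] := idealP J. Qed.
Let JM a x : ideal_set J x -> ideal_set J (a * x).
Proof. by have [_ _] := idealP J; apply. Qed.
Let JN x : ideal_set J x -> ideal_set J (- x).
Proof. by rewrite -mulN1r; apply: JM. Qed.

Fact amalg_mem a j : ideal_set J j -> amalg_pred f J (a, f a + j).
Proof. by move=> Jj; apply/asboolP; exists a, j. Qed.
Definition mk_amalg a j (Jj : ideal_set J j) : C := Sub (a, f a + j) (amalg_mem a Jj).

Lemma amalgP (x : C) : exists a j (Jj : ideal_set J j), x = mk_amalg a Jj.
Proof.
have /asboolP[a [j [Jj xE]]] := valP x.
by exists a, j, Jj; apply: val_inj.
Qed.

Definition amalg_diag a : C := mk_amalg a J0.
Definition amalg_right b (Jb : ideal_set J b) : C := mk_amalg 0 Jb.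

Lemma amalg_eq (x y : C) :
  (val x).1 = (val y).1 -> (val x).2 = (val y).2 -> x = y.
Proof.
by move=> x1 x2; apply: val_inj; rewrite [LHS]surjective_pairing x1 x2 -surjective_pairing.
Qed.

Lemma amalg_right2 b (Jb : ideal_set J b) : (val (amalg_right Jb)).2 = b.
Proof. by rewrite /= rmorph0 add0r. Qed.

(** A nilpotent (a, f(a) + j) has a nilpotent; once a = 0, the remaining j is nilpotent and in [J].
    Conversely, nilpotents of [A] and of [J] embed as (a, f(a)) and (0, b). *)
Lemma amalg_reduced : reduced C <-> reduced A /\ nilradical B `&` J = [set 0].
Proof.
have valX (x : C) n : val (x ^+ n) = ((val x).1 ^+ n, (val x).2 ^+ n).
  elim: n => // n IHn; rewrite exprS !exprS.
  by transitivity (val x * val (x ^+ n)); [|rewrite IHn].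
split=> [rC|[rA nilJ]].
  split; apply/seteqP; split=> [a|a /= ->].
  - move=> [n an]; have : amalg_diag a = 0.
      apply: (reduced_exp (n := n) rC); apply: val_inj; rewrite valX /= addr0.
      by rewrite -rmorphXn an rmorph0.
    by move=> /(congr1 (fun x : C => (val x).1)).
  - by exists 1%N.
  - move=> [[n an] Ja]; have : amalg_right Ja = 0.
      (* The extra power makes the first component 0^(n+1) vanish even when n = 0. *)
      apply: (reduced_exp (n := n.+1) rC); apply: val_inj; rewrite valX /=.
      by rewrite rmorph0 add0r exprS mul0r exprS an mulr0.
    by move=> /(congr1 (fun x : C => (val x).2)); rewrite amalg_right2.
  - by split; [exists 1%N|].
apply/seteqP; split=> [x [n]|_ ->]; last by exists 1%N.
have [a [j [Jj ->]]] := amalgP x => /(congr1 val); rewrite valX => -[an jn].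
have a0 := reduced_exp rA an.
have : (nilradical B `&` J) j.
  by split=> //; exists n; rewrite a0 rmorph0 add0r in jn.
by rewrite nilJ => j0; apply: amalg_eq; rewrite /= ?a0 ?j0 ?rmorph0 ?addr0.
Qed.

Lemma prime_leftE p (x : C) : prime_left f J p x <-> p (val x).1.
Proof.
split=> [[a [j [pa _ ->]]]//|]; have [a [j [Jj ->]]] := amalgP x => pa.
by exists a, j.
Qed.

Lemma prime_left_prime p : Spec A p -> Spec C (prime_left f J p).
Proof.
move=> [[p0 pD pM] p1 pmul]; split; first split.
- exact/prime_leftE.
- by move=> x y /prime_leftE px /prime_leftE py; apply/prime_leftE; apply: pD.
- by move=> a x /prime_leftE px; apply/prime_leftE; apply: pM.
- by move=> /prime_leftE.
- by move=> x y /prime_leftE /pmul[] ?; [left|right]; apply/prime_leftE.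
Qed.

Lemma prime_right_prime q : Spec B q -> Spec C (prime_right f J q).
Proof.
move=> [[q0 qD qM] q1 qmul].
split; [split; [exact: q0| |]|exact: q1|by move=> x y /qmul].
- by move=> x y; apply: qD.
- by move=> a x; apply: qM.
Qed.

(** P contains the kernel 0 x J of the projection to [A], so it is an inverse image from [A], read
    off along a -> (a, f(a)). *)
Lemma contraction_left P : Spec C P ->
  (forall b (Jb : ideal_set J b), P (amalg_right Jb)) ->
  exists2 p, Spec A p & P = prime_left f J p.
Proof.
move=> [[P0 PD PM] P1 Pmul] PJ.
have PE x : P x <-> P (amalg_diag (val x).1).
  have [a [j [Jj ->]]] := amalgP x.
  split=> [Px|Px].
    rewrite (_ : amalg_diag _ = mk_amalg a Jj + amalg_right (JN Jj)).
      exact: PD.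
    by apply: amalg_eq; rewrite /= ?rmorph0 ?add0r ?addr0 // addrK.
  rewrite (_ : mk_amalg _ _ = amalg_diag a + amalg_right Jj).
    exact: PD.
  by apply: amalg_eq; rewrite /= ?rmorph0 ?add0r ?addr0.
exists [set a | P (amalg_diag a)].
  split; first split.
  - by apply/(PE 0).
  - move=> a b Pa Pb; rewrite /= (_ : amalg_diag _ = amalg_diag a + amalg_diag b).
      exact: PD.
    by apply: amalg_eq; rewrite /= ?addr0 ?rmorphD.
  - move=> a b Pb; rewrite /= (_ : amalg_diag _ = amalg_diag a * amalg_diag b).
      exact: PM.
    by apply: amalg_eq; rewrite /= ?addr0 ?rmorphM.
  - by move=> /= P1'; apply/P1/PE.
  - move=> a b /= Pab; apply: Pmul.
    by rewrite (_ : _ * _ = amalg_diag (a * b)) //; apply: amalg_eq; rewrite /= ?addr0 ?rmorphM.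
apply/seteqP; split=> [x /PE Px|x /prime_leftE Px]; first exact/prime_leftE.
exact/PE.
Qed.

(** Multiplying x by (0, j) gives (0, x_2 j), which depends only on the second component. As (0, j)
    is outside P, membership of x is decided by x_2, and q consists of the b with (0, b j) in P. *)
Lemma contraction_right P j (Jj : ideal_set J j) : Spec C P ->
  ~ P (amalg_right Jj) ->
  exists q, [/\ Spec B q, ~ q j & P = prime_right f J q].
Proof.
move=> [[P0 PD PM] P1 Pmul] Pj.
pose m b : C := amalg_right (JM b Jj).
have PE (x : C) : P x <-> P (m (val x).2).
  have -> : m (val x).2 = x * amalg_right Jj.
    by apply: amalg_eq; rewrite /= ?rmorph0 ?add0r ?mulr0.
  by split=> [|/Pmul[]//]; rewrite mulrC; apply: PM.
exists [set b | P (m b)]; split.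
- split; first split.
  + by apply/(PE 0).
  + move=> a b Pa Pb; rewrite /= (_ : m _ = m a + m b); first exact: PD.
    by apply: amalg_eq; rewrite /= ?rmorph0 ?add0r ?addr0 ?mulrDl.
  + move=> a b Pb.
    have : P (m a * m b) by apply: PM.
    (* Both sides are (0, a b j^2), and primality cancels the factor (0, j). *)
    rewrite (_ : _ * _ = m (a * b) * amalg_right Jj) => [/Pmul[]//|].
    by apply: amalg_eq; rewrite /= ?rmorph0 ?add0r ?mulr0 //; ring.
  + by move=> /= Pm1; apply/P1/PE.
  + move=> a b /= Pab; apply: Pmul.
    rewrite (_ : _ * _ = m (a * b) * amalg_right Jj); first by rewrite mulrC; apply: PM.
    by apply: amalg_eq; rewrite /= ?rmorph0 ?add0r ?mulr0 //; ring.
- move=> /= Pmj; apply: Pj; apply/PE.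
  by rewrite amalg_right2.
- by apply/seteqP; split=> [x /PE Px|x Px]; [exact: Px|exact/PE].
Qed.

Lemma prime_left_sub p p' : prime_left f J p `<=` prime_left f J p' -> p `<=` p'.
Proof.
move=> pp a pa; have /pp/prime_leftE// : prime_left f J p (amalg_diag a).
exact/prime_leftE.
Qed.

(** Test the inclusion on (0, b j) with b in [q] and j in [J] outside [q']. *)
Lemma prime_right_sub q q' : Spec B q -> Spec B q' -> ~ ideal_set J `<=` q' ->
  prime_right f J q `<=` prime_right f J q' -> q `<=` q'.
Proof.
move=> [[_ _ qM] _ _] [_ _ q'mul] nJ qq b qb; have [j [Jj q'j]] := nonsubset nJ.
have : prime_right f J q' (amalg_right (JM b Jj)).
  by apply: qq; rewrite /prime_right /= rmorph0 add0r mulrC; apply: qM.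
by rewrite /prime_right /= rmorph0 add0r => /q'mul[].
Qed.

(** With its converse [preimage_sub_prime_right] this explains [amalgX]: a prime [p] belongs to it
    exactly when p'^f contains the prime attached to some q not containing [J]. *)
Lemma prime_right_sub_left p q :
  prime_right f J q `<=` prime_left f J p -> f @^-1` ideal_add J q `<=` p.
Proof.
move=> qp a [b qb [j Jj fa]].
have /qp/prime_leftE// : prime_right f J q (mk_amalg a (JN Jj)).
by rewrite /prime_right /= -fa addrK.
Qed.

Lemma prime_left_sub_right p q : Spec A p ->
  prime_left f J p `<=` prime_right f J q -> ideal_set J `<=` q.
Proof.
move=> [[p0 _ _] _ _] pq j Jj.
have /pq : prime_left f J p (amalg_right Jj) by apply/prime_leftE.
by rewrite /prime_right /= rmorph0 add0r.
Qed.

Lemma preimage_sub_prime_right p q :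
  f @^-1` ideal_add J q `<=` p -> prime_right f J q `<=` prime_left f J p.
Proof.
move=> qp x; have [a [j [Jj ->]]] := amalgP x => qx.
apply/prime_leftE; apply: qp; exists (f a + j) => //.
by exists (- j); [exact: JN|rewrite addrK].
Qed.

Lemma not_V_sub q : Spec B q -> ~ V J q -> ~ ideal_set J `<=` q.
Proof. by move=> qS nV Jq; apply: nV. Qed.

Lemma amalg_prime_cases P : Spec C P ->
  (exists2 p, Spec A p & P = prime_left f J p) \/
  (exists2 q, (Spec B `\` V J) q & P = prime_right f J q).
Proof.
move=> PS; have [|nPJ] := pselect (forall b (Jb : ideal_set J b), P (amalg_right Jb)).
  by left; apply: contraction_left.
have [j [Jj Pj]] : exists j (Jj : ideal_set J j), ~ P (amalg_right Jj).
  apply: contrapT => nP; apply: nPJ => b Jb; apply: contrapT => Pb.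
  by apply: nP; exists b, Jb.
have [q [qS qj PE]] := contraction_right PS Pj.
by right; exists q => //; split=> // -[_ /(_ j Jj)].
Qed.

(** Primes of the same kind are ordered as in [A] or in [B]. A left prime contains 0 x J, so is
    never inside a right one with q not containing [J]; a right prime inside a left one is what
    [amalgX] excludes. *)
Lemma amalg_Min : Min C =
  [set prime_left f J p | p in Min A `\` amalgX f J] `|`
  [set prime_right f J q | q in Min B `\` V J].
Proof.
apply/seteqP; split=> [P [PS Pmin]|P [|]].
- have [[p pS PE]|[q [qS qJ] PE]] := amalg_prime_cases PS.
    left; exists p => //; split; first split=> // p' p'S p'p.
      apply/seteqP; split=> //; apply: prime_left_sub.
      rewrite -PE (Pmin _ (prime_left_prime p'S)) // PE => x /prime_leftE px.
      by apply/prime_leftE/p'p.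
    move=> [q [qS qJ] [_ /preimage_sub_prime_right qp]].
    apply: (not_V_sub qS qJ); apply: (prime_left_sub_right pS).
    by rewrite -PE -(Pmin _ (prime_right_prime qS)) ?PE.
  (* A prime below [q] cannot contain [J] either, so it too gives a prime of the right kind. *)
  right; exists q => //; split=> //; split=> // q' q'S q'q.
  apply/seteqP; split=> //; apply: prime_right_sub => //.
    by move=> Jq'; apply: (not_V_sub qS qJ); apply: subset_trans q'q.
  by rewrite -PE (Pmin _ (prime_right_prime q'S)) // PE => x; apply: q'q.
- move=> [p [[pS pmin] pX] <-]; split; first exact: prime_left_prime.
  move=> P' /amalg_prime_cases[[p' p'S ->] /prime_left_sub pp|[q qS ->] qp].
    by rewrite (pmin p').
  by case: pX; exists q => //; split=> //; apply: prime_right_sub_left.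
- move=> [q [[qS qmin] qJ] <-]; split; first exact: prime_right_prime.
  move=> P' /amalg_prime_cases[[p' p'S ->] pq|[q' [q'S q'J] ->] qq].
    by case: (not_V_sub qS qJ); apply: prime_left_sub_right pq.
  by rewrite (qmin q') //; apply: prime_right_sub qq => //; apply: not_V_sub.
Qed.

End AmalgamPrimes.

Theorem proposition4p11 (A B : comPzRingType) (f : {rmorphism A -> B})
    (J : ideal B) :
  tauq_semisimple (amalg f J) <->
  [/\ reduced A,
      nilradical B `&` J = [set 0],
      finite_set [set prime_left f J p | p in Min A `\` amalgX f J]
    & finite_set [set prime_right f J q | q in Min B `\` V J]].
Proof.
rewrite tauq_semisimple_reduced_finite_Min amalg_reduced amalg_Min finite_setU.
by split=> [[[? ?] []]|[]].
Qed.
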